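(* Suppose that $\rho\notin\{i\Delta:i\in\mathbb{N}\}$. Then there exist constants $\sigma,\eta,c>0$ and a set of probability one on which the following three statements hold: $$\lim_{n\to\infty}\ \sup_{t\in[\sigma,T]}\left|\ell_n(t)-\lfloor\rho\rfloor_\Delta\right|=0,$$ $$\lim_{n\to\infty}\ \sup_{t\in[\sigma,T]}|1-q_n(t,i)|=0\quad\text{for all } i\le\lfloor\rho\rfloor_\Delta,$$ $$\limsup_{n\to\infty}\ \sup_{t\in[\sigma,T]}\ \sum_{i>\lfloor\rho\rfloor_\Delta+\Delta}q_n(t,i)\,e^{\eta(t-\sigma)}\le c .$$ The constants $\sigma$, $\eta$ and $c$ do not depend on $T$ (if $\sigma>T$, the three statements are void).
   Context: Conventions: $\mathbb{N}=\{0,1,2,\dots\}$; $f(t^-)$ is the left limit; $\mathbf{1}\{\cdot\}$ is the indicator; $\Delta\ge1$ is a fixed integer and $\lfloor x\rfloor_\Delta=\max\{k\Delta:k\in\mathbb{Z},\,k\Delta\le x\}$. Model (Coxian service times, constant arrival rate, basic learning scheme). Fix $T>0$, a constant $\lambda\ge0$, an integer $r\ge1$, rates $\mu_1,\dots,\mu_r>0$ and probabilities $p_1,\dots,p_{r-1}\in(0,1)$, $p_r=0$. A task starts in phase $1$; it completes phase $m$ after an exponential time of mean $1/\mu_m$, then moves to phase $m+1$ with probability $p_m$ or leaves with probability $1-p_m$. The mean service time is $\frac1\mu=\sum_{i=1}^r(1-p_i)\left(\prod_{j=1}^{i-1}p_j\right)\sum_{k=1}^i\frac1{\mu_k}$ and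 $\rho=\lambda/\mu$. System $n$ has $n$ server pools. Fix an enumeration $\{\nu_i:i\ge0\}$ of $\mathbb{N}^r$ and let $\Sigma_i=\sum_{m=1}^r\nu_i(m)$; a pool has profile $\nu$ if it has exactly $\nu(m)$ tasks in phase $m$ for each $m$. Let $s_n(t,\nu)$ be the fraction of pools with profile $\nu$, $q_n(t,i)=\sum_{k:\Sigma_k\ge i}s_n(t,\nu_k)$ the fraction with at least $i$ tasks, $u_n=\sum_{i\ge1}q_n(i)$, and $\ell_n$ the threshold. Let $S=\{s\in[0,1]^{\mathbb{N}^r}:\sum_\nu s(\nu)=1\}$. Primitives: (1) independent unit-rate Poisson processes $\mathcal{N}_{(\nu,i,j)}$, $\nu\in\mathbb{N}^r$, $i\in\{0,\dots,r\}$, $j\in\{0,1\}$; (2) i.i.d. $U_j$, $j\ge1$, uniform on $[0,1)$; (3) random $s_n(0)\in S$ with $ns_n(0,\nu)\in\mathbb{N}$ for all $\nu$. There are a deterministic $s(0)\in S$ with $s_n(0,\nu)\to s(0,\nu)$ for all $\nu$ almost surely, and $B\in\mathbb{N}$ with $q_n(0,B+1)=0$ and $\ell_n(0)\le B$ for all $n$ almost surely. The three families live on three probability spaces and $(\Omega,\mathcal{F},\mathbb{P})$ is the completion of the product space. For $s\in S$ let $q(j)=\sum_{k:\Sigma_k\ge j}s(\nu_k)$ and, for $i\ge0$, $I_i(s)=\left[1-\sum_{k\ge i}s(\nu_k),\,1-\sum_{k\ge i+1}s(\nu_k)\right)$ and, if $q(j)<1$, $$J_i(s,j)=\left[1-\frac{\sum_{k\ge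 i}s(\nu_k)\mathbf{1}\{\Sigma_k<j\}}{1-q(j)},\ 1-\frac{\sum_{k\ge i+1}s(\nu_k)\mathbf{1}\{\Sigma_k<j\}}{1-q(j)}\right),$$ with $J_i(s,j)=\emptyset$ if $q(j)=1$. For $\ell\in\mathbb{N}$, $h=\ell+\Delta$, $i\ge0$, $j\ge1$, let $r_{ij}(s,\ell)$ equal $\mathbf{1}\{U_j\in J_i(s,\ell)\}$ if $\Sigma_i<\ell$; $\mathbf{1}\{q(\ell)=1,\,U_j\in J_i(s,h)\}$ if $\ell\le\Sigma_i<h$; and $\mathbf{1}\{q(h)=1,\,U_j\in I_i(s)\}$ if $\Sigma_i\ge h$ (the $j$-th arriving task is sent to a pool with profile $\nu_i$ iff $r_{ij}=1$). Let $\mathcal{N}_n^\lambda(t)=\mathcal{N}_{(0,0,0)}(n\lambda t)$ with jump times $\tau_{n,1}<\tau_{n,2}<\cdots$. On a set $\Gamma_0$ of probability one, càdlàg processes $s_n,\ell_n$ on $[0,T]$ are constructed by forward induction on the jumps so that, for all $n$ and $t$, $s_n(t)=s_n(0)+\bar{\mathcal{A}}_n(t)+\bar{\mathcal{P}}_n(t)+\bar{\mathcal{D}}_n(t)$ and $\ell_n(t)=\lfloor u_n(t)\rfloor_\Delta$, where, with $e_1,\dots,e_r$ the canonical basis, $$\bar{\mathcal{A}}_n(t,\nu_i)=\mathcal{A}_n(t,\nu_i-e_1)-\mathcal{A}_n(t,\nu_i),\quad \bar{\mathcal{P}}_n(t,\nu_i)=\sum_{m=1}^{r-1}[\mathcal{P}_n(t,\nu_i+e_m-e_{m+1},m)-\mathcal{P}_n(t,\nu_i,m)],$$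 $$\bar{\mathcal{D}}_n(t,\nu_i)=\sum_{m=1}^{r}[\mathcal{D}_n(t,\nu_i+e_m,m)-\mathcal{D}_n(t,\nu_i,m)],\quad \mathcal{A}_n(t,\nu_i)=\frac1n\sum_{j=1}^{\mathcal{N}_n^\lambda(t)}r_{ij}(s_n(\tau_{n,j}^-),\ell_n(\tau_{n,j}^-)),$$ $$\mathcal{P}_n(t,\nu_i,m)=\frac1n\mathcal{N}_{(\nu_i,m,0)}\left(n\int_0^tp_m\mu_m\nu_i(m)s_n(\tau,\nu_i)\,d\tau\right),\quad \mathcal{D}_n(t,\nu_i,m)=\frac1n\mathcal{N}_{(\nu_i,m,1)}\left(n\int_0^t(1-p_m)\mu_m\nu_i(m)s_n(\tau,\nu_i)\,d\tau\right),$$ and $\mathcal{A}_n(t,\nu)$, $\mathcal{P}_n(t,\nu,m)$ are zero if $\nu$ has a negative component. *)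

(* Defs.v *)
From HB Require Import structures.
From mathcomp Require Import all_boot all_order all_algebra.
From mathcomp Require Import finmap.
From mathcomp Require Import all_classical all_reals all_analysis.

Set Implicit Arguments.
Unset Strict Implicit.
Unset Printing Implicit Defensive.

Import Order.TTheory GRing.Theory Num.Theory.
Import numFieldNormedType.Exports.

Local Open Scope classical_set_scope.
Local Open Scope ring_scope.

(** * Probability *)

Section Probability.
Context {d : measure_display} {T : measurableType d} {R : realType}.
Variable P : probability T R.

Definition mutually_independent {I : choiceType} (D : set I)
    (F : I -> set (set T)) : Prop :=
  forall (J : {fset I}) (A : I -> set T),
    (forall i, i \in J -> D i /\ F i (A i)) ->
    P (\bigcap_(i in [set` J]) A i) = (\prod_(i <- J) P (A i))%E.

Definition sigma_rv {d'} {rT : measurableType d'} (X : T -> rT) :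
    set (set T) :=
  preimage_set_system setT X measurable.

Definition sigma_process {d'} {rT : measurableType d'} (X : R -> T -> rT) :
    set (set T) :=
  <<s \bigcup_(t in [set t | 0 <= t]) sigma_rv (X t) >>.

(* The subtraction of naturals is not truncating on the almost sure event
   where the paths are nondecreasing. *)
Record unit_poisson_process (N : R -> T -> nat) : Prop := UnitPoissonProcess {
  poisson_measurable : forall t, 0 <= t -> measurable_fun setT (N t) ;
  poisson_paths : \forall w \ae P,
    [/\ N 0 w = 0%N,
        (forall t u, 0 <= t -> t <= u -> (N t w <= N u w)%N) &
        (forall t, 0 <= t -> N x w @[x --> t^'+] --> N t w)] ;
  poisson_increments_independent : forall t : nat -> R,
    0 <= t 0%N -> {homo t : i j / (i <= j)%N >-> i <= j} ->
    mutually_independent [set: nat]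
      (fun i => sigma_rv (fun w => N (t i.+1) w - N (t i) w)%N) ;
  poisson_increments_law : forall t u (k : nat), 0 <= t -> t < u ->
    P [set w | (N u w - N t w)%N = k] = (poisson_pmf (u - t) k)%:E }.

Definition independent_unit_poisson {I : choiceType}
    (N : I -> R -> T -> nat) : Prop :=
  (forall i, unit_poisson_process (N i)) /\
  mutually_independent [set: I] (fun i => sigma_process (N i)).

(* Only the variables U 1, U 2, ... are constrained. *)
Definition iid_uniform (U : nat -> T -> R) : Prop :=
  [/\ (forall j, (0 < j)%N -> measurable_fun setT (U j)),
      (forall j, (0 < j)%N -> forall A : set R, measurable A ->
         P (U j @^-1` A) = lebesgue_measure (A `&` `[0, 1[)) &
      mutually_independent [set j | (0 < j)%N] (fun j => sigma_rv (U j))].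

End Probability.

(** * Rounding down to a multiple of [Delta] *)

Definition floor_mul {R : realType} (Delta : nat) (x : R) : int :=
  Num.floor (x / Delta%:R) * Delta%:Z.

Lemma floor_mul_max {R : realType} (Delta : nat) (x : R) : (0 < Delta)%N ->
  (floor_mul Delta x)%:~R <= x /\
  forall k : int, (k * Delta%:Z)%:~R <= x -> k * Delta%:Z <= floor_mul Delta x.
Proof.
move=> Delta_gt0.
have D0 : (0 : R) < Delta%:R by rewrite ltr0n.
split; first by rewrite /floor_mul intrM -ler_pdivlMr// floor_le.
move=> k; rewrite intrM -ler_pdivlMr// => kx.
by rewrite /floor_mul ler_wpM2r// floor_ge_int.
Qed.

(** * Profiles and occupancy states *)

(* There are r.+1 phases; the phase called m (1 <= m <= r.+1) on paper is the
   ordinal of value m - 1. *)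
Definition profile (r : nat) := {ffun 'I_r.+1 -> nat}.

Definition ntasks {r : nat} (v : profile r) : nat := (\sum_m v m)%N.

Definition incr {r : nat} (v : profile r) (m : 'I_r.+1) : profile r :=
  [ffun k => (v k + (k == m))%N].

(* v - e_m; only used when v m != 0 *)
Definition decr {r : nat} (v : profile r) (m : 'I_r.+1) : profile r :=
  [ffun k => (v k - (k == m))%N].

(* For m < r (0-based), the transition m goes from phase [src m] to [tgt m]. *)
Definition src {r : nat} (m : 'I_r) : 'I_r.+1 := widen_ord (leqnSn r) m.
Definition tgt {r : nat} (m : 'I_r) : 'I_r.+1 := lift ord0 m.

(* Labels (v, i, j) of the driving Poisson processes, with j = 0 encoded as
   false and j = 1 as true. *)
Definition clock (r : nat) : Type := (profile r * 'I_r.+2 * bool)%type.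

Definition arrival_clock (r : nat) : clock r := ([ffun=> 0%N], ord0, false).
Definition transition_clock {r : nat} (v : profile r) (m : 'I_r.+1) : clock r :=
  (v, lift ord0 m, false).
Definition departure_clock {r : nat} (v : profile r) (m : 'I_r.+1) : clock r :=
  (v, lift ord0 m, true).


Section States.
Context {R : realType} {r : nat}.
Implicit Type s : profile r -> R.

Definition simplex s : Prop :=
  (forall v, 0 <= s v <= 1) /\ (\esum_(v in setT) (s v)%:E)%E = 1%E.

Variable nu : nat -> profile r.

(* The sums below have nonnegative terms; they are bounded by 1 on the simplex,
   so that [fine] loses nothing there. *)
Definition tail_sum s (C : pred nat) (i : nat) : R :=
  fine (\sum_(i <= k <oo | C k) (s (nu k))%:E)%E.

Definition q s (j : nat) : R := tail_sum s (fun k => (j <= ntasks (nu k))%N) 0.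

(* Finite as soon as the number of tasks per pool is bounded. *)
Definition u s : R := fine (\sum_(1 <= i <oo) (q s i)%:E)%E.

Definition I_ s (i : nat) : set R :=
  `[1 - tail_sum s xpredT i, 1 - tail_sum s xpredT i.+1[%classic.

Definition J_ s (i j : nat) : set R :=
  let C k := (ntasks (nu k) < j)%N in
  if q s j < 1 then
    `[1 - tail_sum s C i / (1 - q s j), 1 - tail_sum s C i.+1 / (1 - q s j)[%classic
  else set0.

(* The indicator that a task drawing x from the uniform distribution is sent to
   a pool with profile nu i, in state s with threshold l. *)
Definition dispatch (Delta : nat) s (l : nat) (i : nat) (x : R) : R :=
  let h := (l + Delta)%N in
  if (ntasks (nu i) < l)%N then \1_(J_ s i l) x
  else if (ntasks (nu i) < h)%N then (q s l == 1)%:R * \1_(J_ s i h) x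
  else (q s h == 1)%:R * \1_(I_ s i) x.

End States.

Definition mean_service {R : realType} {r : nat} (mu p : 'I_r.+1 -> R) : R :=
  \sum_(i < r.+1) (1 - p i) * (\prod_(j < r.+1 | (j < i)%N) p j) *
    \sum_(k < r.+1 | (k <= i)%N) (mu k)^-1.

(* lambda / mu, where 1 / mu is the mean service time. *)
Definition load {R : realType} {r : nat} (lambda : R) (mu p : 'I_r.+1 -> R) : R :=
  lambda * mean_service mu p.

(** * Sample paths *)

Definition cadlag {R : realType} {E : ptopologicalType} (T : R) (f : R -> E) :
    Prop :=
  (forall t, 0 <= t < T -> f x @[x --> t^'+] --> f t) /\
  (forall t, 0 < t <= T -> cvg (f x @[x --> t^'-])).

Definition left_lim {R : realType} {E : ptopologicalType} (f : R -> E) (t : R) :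
    E :=
  lim (f x @[x --> t^'-]).

Section Paths.
Context {R : realType} {r : nat}.
Variables (Delta : nat) (lambda : R) (mu p : 'I_r.+1 -> R).
(* idx is the inverse of the enumeration nu of the profiles. *)
Variables (nu : nat -> profile r) (idx : profile r -> nat).
Variables (N : clock r -> R -> nat) (U : nat -> R).
Variable n : nat.
Variables (s : R -> profile r -> R) (l : R -> nat).

Definition arrivals (t : R) : nat := N (arrival_clock r) (n%:R * lambda * t).

Definition jump_time (j : nat) : R :=
  inf [set t | 0 <= t /\ (j <= arrivals t)%N].

Definition A_ (t : R) (v : profile r) : R :=
  n%:R^-1 * \sum_(1 <= j < (arrivals t).+1)
    dispatch nu Delta (fun w => left_lim (s ^~ w) (jump_time j))
      (left_lim l (jump_time j)) (idx v) (U j).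

Definition P_ (t : R) (v : profile r) (m : 'I_r) : R :=
  n%:R^-1 * (N (transition_clock v (src m))
    (n%:R * Rintegral lebesgue_measure `[0, t]
       (fun x => p (src m) * mu (src m) * (v (src m))%:R * s x v)))%:R.

Definition D_ (t : R) (v : profile r) (m : 'I_r.+1) : R :=
  n%:R^-1 * (N (departure_clock v m)
    (n%:R * Rintegral lebesgue_measure `[0, t]
       (fun x => (1 - p m) * mu m * (v m)%:R * s x v)))%:R.

(* The conditionals implement the convention that A_ and P_ vanish on profiles
   with a negative component. *)
Definition A_bar (t : R) (v : profile r) : R :=
  (if v ord0 == 0%N then 0 else A_ t (decr v ord0)) - A_ t v.

Definition P_bar (t : R) (v : profile r) : R :=
  \sum_(m < r)
    ((if v (tgt m) == 0%N then 0 else P_ t (decr (incr v (src m)) (tgt m)) m)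
     - P_ t v m).

Definition D_bar (t : R) (v : profile r) : R :=
  \sum_(m < r.+1) (D_ t (incr v m) m - D_ t v m).

Record is_trajectory (T : R) (s_init : profile r -> R) : Prop := IsTrajectory {
  trajectory_simplex : forall t, 0 <= t <= T -> simplex (s t) ;
  trajectory_cadlag_s : forall v, cadlag T (s ^~ v) ;
  trajectory_cadlag_l : cadlag T l ;
  trajectory_s : forall t, 0 <= t <= T -> forall v,
    s t v = s_init v + A_bar t v + P_bar t v + D_bar t v ;
  trajectory_l : forall t, 0 <= t <= T ->
    (l t)%:Z = floor_mul Delta (u nu (s t)) }.

End Paths.

(** * The initial condition *)

Section Initial.
Context {R : realType} {r : nat} {d : measure_display} {T : measurableType d}.
Variables (P : probability T R) (nu : nat -> profile r) (Delta : nat).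

(* The system of index 0 is irrelevant. The threshold at time zero is, as at
   every other time, u rounded down to a multiple of Delta. *)
Record initial_condition (s0 : nat -> T -> profile r -> R)
    (s_lim : profile r -> R) (B : nat) : Prop := InitialCondition {
  initial_measurable : forall n v, (0 < n)%N ->
    measurable_fun setT (fun w => s0 n w v) ;
  initial_simplex : forall n w, (0 < n)%N -> simplex (s0 n w) ;
  initial_counts : forall n w v, (0 < n)%N ->
    exists k : nat, n%:R * s0 n w v = k%:R ;
  initial_lim_simplex : simplex s_lim ;
  initial_cvg : \forall w \ae P, forall v, s0 n w v @[n --> \oo] --> s_lim v ;
  initial_bounded : \forall w \ae P, forall n, (0 < n)%N ->
    q nu (s0 n w) B.+1 = 0 /\ floor_mul Delta (u nu (s0 n w)) <= B%:Z }.

End Initial.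

(* Main.v *)
Require Import Defs.
From mathcomp Require Import all_boot all_order all_algebra.
From mathcomp Require Import all_classical all_reals all_analysis.
From mathcomp Require Import measurable_realfun ring lra zify.

Set Implicit Arguments.
Unset Strict Implicit.
Unset Printing Implicit Defensive.

Import Order.TTheory GRing.Theory Num.Theory.
Import numFieldNormedType.Exports.

Local Open Scope classical_set_scope.
Local Open Scope ring_scope.

(** The proof follows linear functionals of the state, sum_v phi v * s t v, and
compares each of them with a barrier instead of solving a fluid limit equation.

Summing the equations of a trajectory against phi ([balance]) shows that such a
functional moves by the contribution of the routed arrivals plus the integral of
a drift that is linear in the state, up to an error made by replacing the
Poisson clocks by their means ([mass_increment_le]). These errors vanish
uniformly on compact time intervals by the law of large numbers
([poisson_lln_path]), provided that finitely many clocks matter. This is why one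
first shows that no pool ever exceeds a fixed number M of tasks
([capped_forever]): a task never joins a pool with l + Delta tasks or more,
because the mean number of tasks per pool is less than l + Delta, and l is at
most that mean, which grows no faster than the arrivals.

Three families of functionals are then enough.

- The mean number of tasks in phase m gains lambda (if m is the first phase) or
  the flow out of the previous phase, and loses mu m times itself. By induction
  on m it gets and stays close to its equilibrium value ([cascade_uniform]).
  Summing over m, the mean number of tasks per pool is close to rho, and since
  rho is strictly between L and L + Delta the threshold is L ([threshold_eq]).

- The shortfall, the mean of the positive part of L - (number of tasks). As long
  as it is positive, each arrival goes to a pool with fewer than L tasks and
  reduces it by 1 / n. It increases only through departures from pools with at
  most L tasks. All departures together have a rate close to lambda, and a rate
  bounded below by a multiple of rho - L belongs to pools with more than L tasks,
  so that the shortfall decreases at a constant speed until it vanishes, and then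
  stays negligible ([filling]).

- The excess, the mean of the positive part of (number of tasks) - (L + Delta).
  No arrival contributes to it, and departures make it decrease at a rate
  proportional to it, hence exponentially fast ([drain]).

The times needed for this depend on the rates, on B and on the distance from rho
to the multiples of Delta, and not on the horizon T; the horizon only decides how
large n must be. *)

(** * Law of large numbers for Poisson processes *)

(** Exponential tilting: multiplying the Poisson weights of parameter m by
expR (theta * k) gives, up to the factor expR (m * (expR theta - 1)), the weights
of parameter m * expR theta, whose total mass is 1. *)
Lemma poisson_tail (R : realType) (m theta a : R) (S : set nat) :
  0 < m -> (forall k, S k -> theta * a <= theta * k%:R) ->
  (poisson_prob m 0 S <= (expR (m * (expR theta - 1) - theta * a))%:E)%E.
Proof.
move=> m0 Sa; set c := expR _.
have me0 : 0 < m * expR theta by rewrite mulr_gt0 // expR_gt0.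
apply: (@le_trans _ _ (c%:E * poisson_prob (m * expR theta) 0 S)%E); last first.
  rewrite -[leRHS]mule1 lee_wpmul2l ?lee_fin ?expR_ge0//.
  by apply: (@probability_le1 _ _ _ (@poisson_prob R (m * expR theta) 0)).
rewrite /poisson_prob m0 me0.
have p0 x k : (0 <= (@poisson_pmf R x k)%:E)%E.
  by rewrite lee_fin poisson_pmf_ge0.
have E (x : R) : (\esum_(k in S) (poisson_pmf x k)%:E)%E
    = (\sum_(k <oo | k \in S) (poisson_pmf x k)%:E)%E.
  rewrite nneseries_esum; last by move=> k _; exact: p0.
  by rewrite set_mem_set.
rewrite !E -nneseriesZl; last by move=> k _; rewrite lee_fin poisson_pmf_ge0.
apply: lee_nneseries => k; first by move=> *; exact: p0.
rewrite inE => /Sa ka.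
rewrite /poisson_pmf m0 me0 -EFinM lee_fin exprMn.
rewrite [leRHS](_ : _ = m ^+ k / k`!%:R * expR (- m)
   * expR (theta * k%:R - theta * a)); last first.
  have -> : expR (theta * k%:R - theta * a) =
      c * expR (- (m * expR theta)) * expR m * expR (theta * k%:R).
    by rewrite /c -!expRD; congr expR; ring.
  have -> : expR (theta * k%:R) = expR theta ^+ k by rewrite mulrC expRM_natl.
  by rewrite [expR (- m)]expRN; field; rewrite pnatr_eq0 -lt0n fact_gt0 gt_eqF ?expR_gt0.
rewrite ler_peMr//.
  by rewrite mulr_ge0 ?expR_ge0// divr_ge0// exprn_ge0// ltW.
by rewrite -[leLHS]expR0 ler_expR subr_ge0.
Qed.

(** A tilt of exponent eps / (2 + eps) controls the upper tail and one of exponent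
- eps the lower tail; both exponents in [poisson_tail] are then negative multiples
of m. *)
Lemma poisson_deviation (R : realType) (eps : R) : 0 < eps < 1 ->
  exists2 gam : R, 0 < gam & forall m : R, 0 < m ->
  (poisson_prob m 0 [set k | (eps * m < `|k%:R - m|)%R] <=
    (2 * expR (- gam * m))%:E)%E.
Proof.
move=> /andP[e0 e1].
have [th1 [th10 Hth1]] : exists th : R, 0 < th /\
    expR th - 1 - th * (1 + eps) < 0.
  exists (eps / (2 + eps)); split; first by apply: divr_gt0 => //; lra.
  set th := _ / _.
  have th1 : th < 1 by rewrite /th ltr_pdivrMr ?mul1r//; lra.
  have h : expR th <= (1 - th)^-1.
    rewrite -[leLHS]invrK -expRN lef_pV2 ?posrE ?expR_gt0 ?subr_gt0//.
    exact: expR_ge1Dx.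
  apply: (@le_lt_trans _ _ ((1 - th)^-1 - 1 - th * (1 + eps))).
    by rewrite !lerB.
  have -> : (1 - th)^-1 = 1 + eps / 2.
    rewrite /th; field; lra.
  have : eps / 2 < th * (1 + eps).
    have -> : th * (1 + eps) = eps / 2 + eps ^+ 2 / (2 * (2 + eps)).
      by rewrite /th; field; lra.
    by rewrite ltrDl divr_gt0 ?exprn_gt0//; lra.
  by move=> ?; lra.
have [th2 [th20 Hth2]] : exists th : R, 0 < th /\
    expR (- th) - 1 + th * (1 - eps) < 0.
  exists eps; split => //.
  have h : expR (- eps) <= (1 + eps)^-1.
    rewrite expRN lef_pV2 ?posrE ?expR_gt0//; last lra.
    exact: expR_ge1Dx.
  apply: (@le_lt_trans _ _ ((1 + eps)^-1 - 1 + eps * (1 - eps))).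
    by rewrite lerD2r lerB.
  have -> : (1 + eps)^-1 - 1 + eps * (1 - eps) = - (eps ^+ 3 / (1 + eps)).
    by field; lra.
  by rewrite oppr_lt0 divr_gt0 ?exprn_gt0//; lra.
pose g1 := - (expR th1 - 1 - th1 * (1 + eps)).
pose g2 := - (expR (- th2) - 1 + th2 * (1 - eps)).
exists (Num.min g1 g2); first by rewrite lt_min !oppr_gt0 Hth1.
move=> m m0.
pose S1 := [set k : nat | ((1 + eps) * m <= k%:R)%R].
pose S2 := [set k : nat | (k%:R <= (1 - eps) * m)%R].
apply: (@le_trans _ _ (poisson_prob m 0 (S1 `|` S2))).
  apply: le_measure; rewrite ?inE// => k /=.
  rewrite ltr_normr => /orP[] h; [left|right]; rewrite /S1 /S2 /=; lra.
apply: (le_trans (measureU2 _ _ _)) => //.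
rewrite mulr_natl mulr2n EFinD; apply: leeD.
  apply: (le_trans (@poisson_tail _ _ th1 ((1 + eps) * m) _ m0 _)).
    by move=> k; rewrite /S1/= ler_pM2l.
  rewrite lee_fin ler_expR.
  have : Num.min g1 g2 * m <= g1 * m by rewrite ler_pM2r// ge_min lexx.
  by rewrite /g1; lra.
apply: (le_trans (@poisson_tail _ _ (- th2) ((1 - eps) * m) _ m0 _)).
  by move=> k; rewrite /S2/= !mulNr lerN2 ler_pM2l.
rewrite lee_fin ler_expR.
have : Num.min g1 g2 * m <= g2 * m by rewrite ler_pM2r// ge_min lexx orbT.
by rewrite /g2; lra.
Qed.

Section poisson_lln.
Context {d : measure_display} {T : measurableType d} {R : realType}.
Variable P : probability T R.
Variable N : R -> T -> nat.
Hypothesis HN : unit_poisson_process P N.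

(** The increment from 0 is used instead of N m because N vanishes at 0 only almost
surely. *)
Lemma poisson_count_law (m : R) (S : set nat) : 0 < m ->
  P [set w | S (N m w - N 0 w)%N] = poisson_prob m 0 S.
Proof.
move=> m0; pose X w := (N m w - N 0 w)%N.
have mX : measurable_fun setT X.
  by apply: measurable_fun_subn; apply: (poisson_measurable HN) => //; exact: ltW.
have -> : [set w | S (X w)] = \bigcup_(k in S) (X @^-1` [set k]).
  apply/seteqP; split => [w Sw|w [k Sk Xk]]; first by exists (X w).
  by rewrite /= Xk.
rewrite measure_bigcup; last 2 first.
- by move=> k _; rewrite -[X @^-1` _]setTI; exact: mX.
- by move=> i j _ _ [w [/= <- <-]].
rewrite /poisson_prob m0 -[in RHS](set_mem_set S) -nneseries_esum; last first.
  by move=> k _; rewrite lee_fin poisson_pmf_ge0.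
apply: eq_eseriesr => k _.
have := poisson_increments_law HN k (lexx 0) m0.
by rewrite subr0.
Qed.

(** The deviation probabilities at integer times are summable, so that the
Borel-Cantelli lemma applies. *)
Lemma poisson_lln_integers (eps : R) : 0 < eps < 1 ->
  \forall w \ae P, \forall k \near \oo,
    `|(N k%:R w)%:R - k%:R| <= eps * k%:R.
Proof.
move=> e01; have [gam g0 Hg] := poisson_deviation e01.
pose F k := [set w | (eps * k%:R < `|(N k%:R w - N 0 w)%N%:R - k%:R|)%R].
have mF k : measurable (F k).
  have mX : measurable_fun setT (fun w => (N k%:R w - N 0 w)%N).
    by apply: measurable_fun_subn; exact: (poisson_measurable HN).
  rewrite -[F k]setTI.
  exact: (mX measurableT [set i : nat | (eps * k%:R < `|i%:R - k%:R|)%R]).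
have PF : (\sum_(k <oo) P (F k) < +oo)%E.
  have q1 : `|expR (- gam)| < 1.
    by rewrite ger0_norm ?expR_ge0// expR_lt1 oppr_lt0.
  apply: (@le_lt_trans _ _ (\sum_(k <oo) (geometric 2 (expR (- gam)) k)%:E)%E).
    apply: lee_nneseries => // -[_|k _].
      rewrite (_ : F 0%N = set0) ?measure0 ?lee_fin ?geometric_ge0 ?expR_ge0//.
      by apply/seteqP; split => // w; rewrite /F/= subnn mulr0 subrr normr0 ltxx.
    rewrite (poisson_count_law [set i : nat | (eps * k.+1%:R < `|i%:R - k.+1%:R|)%R])//.
    apply: (le_trans (Hg _ _)) => //.
    by rewrite lee_fin /geometric/= ler_pM2l// expRM_natr.
  have -> : (\sum_(k <oo) (geometric 2 (expR (- gam)) k)%:E)%E =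
      limn (EFin \o series (geometric 2 (expR (- gam)))).
    by apply/congr_lim/funext => n /=; rewrite -sumEFin.
  rewrite EFin_lim ?ltry//.
  exact: is_cvg_geometric_series.
have := poisson_paths HN; apply: filterS2 (_ : \forall w \ae P, \forall k \near \oo,
    `|(N k%:R w - N 0 w)%N%:R - k%:R| <= eps * k%:R); last first.
  exists (lim_sup_set F); split.
  - apply: bigcap_measurable => // k _; exact: bigcup_measurable.
  - exact: lim_sup_set_cvg0.
  - move=> w /= H n _; apply: contrapT => Hn; apply: H.
    exists n => // k nk /=; rewrite leNgt; apply/negP => h; apply: Hn.
    by exists k.
move=> w [k0 _ Hk] [N0 _ _]; exists k0 => // k /Hk /=.
by rewrite N0 subn0.
Qed.

(** Monotone paths are squeezed between their values at consecutive integers, which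
makes the convergence uniform on compact intervals. *)
Lemma poisson_lln_path :
  \forall w \ae P,
    [/\ N 0 w = 0%N,
        (forall t u, 0 <= t -> t <= u -> (N t w <= N u w)%N),
        (forall t, 0 <= t -> N x w @[x --> t^'+] --> N t w) &
        forall K eps : R, 0 < eps -> \forall n \near \oo,
          forall th, 0 <= th <= K ->
          `|n%:R^-1 * (N (n%:R * th) w)%:R - th| <= eps].
Proof.
have H : \forall w \ae P, forall i : nat, \forall k \near \oo,
    `|(N k%:R w)%:R - k%:R| <= i.+2%:R^-1 * (k%:R : R).
  apply: ae_foralln => i.
  apply: poisson_lln_integers.
  by rewrite invr_gt0 ltr0n/= invf_lt1 ?ltr1n.
have := poisson_paths HN; apply: filterS2 H => w H [N0 Nm Nr]; split => // K eps e0.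
have [K0|K0] := ltP K 0.
  exists 0%N => // n _ th /andP[t0 tK].
  by have := le_lt_trans (le_trans t0 tK) K0; rewrite ltxx.
pose e := eps / (2 * (K + 1)).
have e_gt0 : 0 < e by rewrite divr_gt0// mulr_gt0//; lra.
have [i Hi] : exists i : nat, i.+2%:R^-1 <= e.
  have [i _ Hi] := nbhs_infty_ger e^-1.
  exists i; rewrite invf_ple ?posrE ?ltr0n//.
  by apply: (le_trans (Hi _ (leqnn i))); rewrite ler_nat -addn2 leq_addr.
have [k0 _ Hk0] := H i.
have [C C0 HC] : exists2 C : R, 0 <= C & forall k : nat, `|(N k%:R w)%:R - k%:R| <= e * k%:R + C.
  exists (\sum_(k < k0) `|(N k%:R w)%:R - k%:R|); first exact: sumr_ge0.
  move=> k; have [k0k|kk0] := leqP k0 k.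
    rewrite -[leLHS]addr0 lerD ?sumr_ge0//.
    by apply: (le_trans (Hk0 _ k0k)); rewrite ler_wpM2r.
  apply: (@le_trans _ _ (\sum_(k < k0) `|(N k%:R w)%:R - k%:R|)).
    by rewrite (bigD1 (Ordinal kk0))//= lerDl sumr_ge0.
  by rewrite lerDr mulr_ge0// ltW.
near=> n => th /andP[th0 thK].
have n0 : 0 < n%:R :> R by rewrite ltr0n; near: n; exists 1%N.
set x := n%:R * th.
have x0 : 0 <= x by rewrite mulr_ge0// ltW.
have /andP[kx xk] := truncn_itv x0.
set k := Num.truncn x in kx xk.
have N1 : (N k%:R w)%:R <= (N x w)%:R :> R by rewrite ler_nat Nm.
have N2 : (N x w)%:R <= (N k.+1%:R w)%:R :> R by rewrite ler_nat Nm// ltW.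
rewrite -natr1 in N2 xk.
have main : `|(N x w)%:R - x| <= e * (x + 1) + C + 1.
  have := HC k; have := HC k.+1; rewrite -!natr1 !ler_norml.
  move=> /andP[A1 A2] /andP[A3 A4].
  have : e * k%:R <= e * x by rewrite ler_pM2l.
  by move=> ?; apply/andP; split; lra.
have -> : n%:R^-1 * (N x w)%:R - th = n%:R^-1 * ((N x w)%:R - x).
  by rewrite mulrBr /x mulKf ?gt_eqF.
rewrite normrM ger0_norm ?invr_ge0// ler_pdivrMl//; apply: (le_trans main).
have E : e * (K + 1) = eps / 2 by rewrite /e; field; rewrite gt_eqF//; lra.
have : e * x <= e * (n%:R * K) by rewrite ler_pM2l// ler_pM2l.
have : e + C + 1 <= n%:R * (eps / 2).
  rewrite -ler_pdivrMr ?divr_gt0//; near: n; exact: nbhs_infty_ger.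
have : n%:R * (e * K) <= n%:R * (eps / 2) by rewrite ler_pM2l// -E ler_pM2l//; lra.
by move=> ? ? ?; lra.
Unshelve. all: by end_near.
Qed.

End poisson_lln.

Lemma iid_uniform_range (d : measure_display) (T : measurableType d) (R : realType)
  (P : probability T R) (U : nat -> T -> R) : iid_uniform P U ->
  \forall w \ae P, forall j, (0 < j)%N -> 0 <= U j w < 1.
Proof.
move=> [mU lawU _]; apply: ae_foralln => -[|j]; first exact: nearW.
have E := lawU j.+1 isT (~` `[0, 1[) (measurableC (measurable_itv _)).
exists (U j.+1 @^-1` ~` `[0, 1[); split.
- rewrite -[_ @^-1` _]setTI; apply: (mU j.+1) => //.
  exact: measurableC.
- by move: E; rewrite setICl measure0.
- by move=> w /= H; rewrite in_itv/= => h; apply: H.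
Qed.

(** * Barriers for approximately monotone functions *)

Section barrier.
Context {R : realType}.
Implicit Types y be : R -> R.

(** After the last time t' at which y is below the barrier, y moves no faster than
the barrier, up to eps. Another eps is lost at t', since y may jump there over
the barrier; the crude bound controls this jump. *)
Lemma barrier y be (a b eps C Lip : R) :
  0 <= C -> 0 <= Lip -> y a <= be a ->
  (forall t u, a <= t -> t <= u -> u <= b -> y u - y t <= C * (u - t) + eps) ->
  (forall t u, a <= t -> t <= u -> u <= b -> be t - be u <= Lip * (u - t)) ->
  (forall t u, a <= t -> t <= u -> u <= b ->
     (forall x, t < x <= u -> be x < y x) -> y u - y t <= be u - be t + eps) ->
  forall t, a <= t <= b -> y t <= be t + 2 * eps.
Proof.
move=> C0 Lip0 ya crude lip drift t /andP[a_t tb].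
pose S := [set x | a <= x <= t /\ y x <= be x].
have Sa : S a by split; rewrite // lexx.
have St : ubound S t by move=> x [/andP[]].
have supS : has_sup S by split; [exists a | exists t].
set t' := sup S.
have at' : a <= t' by apply: ub_le_sup => //; exact: supS.2.
have t't : t' <= t by apply: ge_sup => //; exists a.
have above x : t' < x <= t -> be x < y x.
  move=> /andP[t'x xt]; rewrite ltNge; apply/negP => yx.
  have : x <= t'.
    by apply: ub_le_sup; [exact: supS.2|split=> //; rewrite xt (le_trans at')// ltW].
  by rewrite leNgt t'x.
have H1 := drift t' t at' t't tb above.
have H2 : y t' <= be t' + eps.
  apply/ler_addgt0Pr => e e0.
  pose del := e / (C + Lip + 1).
  have CL : 0 < C + Lip + 1 by lra.
  have del0 : 0 < del by rewrite divr_gt0.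
  (* x is a time below the barrier so close to t' that the crude bound and the
     regularity of the barrier cost at most e between x and t'. *)
  have [x [/andP[ax xt] yx] t'x] := sup_adherent del0 supS.
  rewrite -/t' in t'x.
  have xt' : x <= t' by apply: ub_le_sup; [exact: supS.2|split; rewrite ?ax].
  have t'b := le_trans t't tb.
  have A1 := crude x t' ax xt' t'b; have A2 := lip x t' ax xt' t'b.
  have A3 : (C + Lip) * (t' - x) <= e.
    apply: (@le_trans _ _ ((C + Lip + 1) * del)).
      by rewrite ler_pM//; lra.
    by rewrite /del mulrC divfK// gt_eqF.
  lra.
lra.
Qed.

(** The barrier descends from c + K to c at speed kap, and then stays at c. *)
Lemma settle y (a b c K kap C eps : R) :
  0 <= C -> 0 < kap -> 0 <= K -> y a <= c + K ->
  (forall t u, a <= t -> t <= u -> u <= b -> y u - y t <= C * (u - t) + eps) ->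
  (forall t u, a <= t -> t <= u -> u <= b -> (forall x, t < x <= u -> c < y x) ->
     y u - y t <= - kap * (u - t) + eps) ->
  forall t, a + K / kap <= t <= b -> y t <= c + 2 * eps.
Proof.
move=> C0 kap0 K0 ya crude drift t /andP[at_ tb].
(* The term K - kap * (x - a) is 0 at time a + K / kap. *)
pose be (x : R) := c + Num.max 0 (K - kap * (x - a)).
have maxE x : 0 <= Num.max 0 x :> R by rewrite le_max lexx.
have a_t : a <= t by apply: le_trans at_; rewrite lerDl divr_ge0// ltW.
have lip u v : u <= v -> be u - be v <= kap * (v - u).
  move=> uv; rewrite /be.
  have : Num.max 0 (K - kap * (u - a)) <= Num.max 0 (K - kap * (v - a)) + kap * (v - u).
    rewrite ge_max; apply/andP; split.
      by rewrite addr_ge0// mulr_ge0 ?subr_ge0// ltW.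
    have : K - kap * (v - a) <= Num.max 0 (K - kap * (v - a)) by rewrite le_max lexx orbT.
    by lra.
  by lra.
have -> : c = be t.
  rewrite /be max_l ?addr0// subr_le0 mulrC -ler_pdivrMr//; lra.
apply: (@barrier y be a b eps C kap) => //; last by rewrite a_t.
- exact: ltW.
- by rewrite /be subrr mulr0 subr0 max_r.
- by move=> u v _ uv _; exact: lip.
- move=> u v au uv vb above; have := lip u v uv.
  have := drift u v au uv vb _.
  rewrite mulNr => h ?; have {}h := h _; apply: (le_trans (h _)); last by lra.
  move=> x /above; apply: le_lt_trans; rewrite /be lerDl//.
Qed.

(** Over a unit of time W loses at least del times its final value, so that it is
divided by 1 + del up to an error; del and eps are compared at the times a + k
only, which needs no integration of the exponential. *)
Lemma discrete_decay (W : R -> R) (a b eps del : R) : 0 < del -> 0 <= eps ->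
  (forall t, a <= t <= b -> 0 <= W t) ->
  (forall t u c, a <= t -> t <= u -> u <= b -> (forall x, t < x <= u -> c <= W x) ->
     W u - W t <= - del * c * (u - t) + eps) ->
  forall t, a <= t <= b ->
    W t * expR (ln (1 + del) * (t - a)) <=
    (1 + del) * (W a + eps * (b - a + 1) * expR (ln (1 + del) * (b - a))).
Proof.
move=> del0 eps0 W0 drift.
set eta := ln (1 + del).
have eta0 : 0 <= eta by rewrite ln_ge0//; lra.
have expeta : expR eta = 1 + del by rewrite lnK// posrE; lra.
have mono t u : a <= t -> t <= u -> u <= b -> W u <= W t + eps.
  move=> a_t tu ub; have := drift t u 0 a_t tu ub.
  rewrite mulr0 mul0r => h; have : W u - W t <= 0 + eps.
    by apply: h => x /andP[tx xu]; apply: W0; apply/andP; split; lra.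
  by lra.
have expk k : expR (eta * k%:R) = (1 + del) ^+ k by rewrite expRM_natr expeta.
have step k : a + k%:R <= b ->
    W (a + k%:R) * (1 + del) ^+ k <= W a + k%:R * eps * (1 + del) ^+ k.
  elim: k => [|k IH]; first by rewrite !addr0 !mul0r addr0 expr0 mulr1.
  rewrite -natr1 => kb.
  have k0 : (0 : R) <= k%:R by [].
  have {}IH : W (a + k%:R) * (1 + del) ^+ k <= W a + k%:R * eps * (1 + del) ^+ k.
    by apply: IH; lra.
  set Wk := W (a + k%:R) in IH *; set Wk1 := W (a + _).
  have H : (1 + del) * Wk1 <= Wk + (1 + del) * eps.
    have := drift (a + k%:R) (a + (k%:R + 1)) (Wk1 - eps).
    rewrite -/Wk1 -/Wk.
    have -> : a + (k%:R + 1) - (a + k%:R) = 1 by ring.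
    move=> h; have : Wk1 - Wk <= - del * (Wk1 - eps) * 1 + eps.
      apply: h; [lra|lra|lra|] => x /andP[x1 x2].
      by rewrite lerBlDr; apply: mono; lra.
    by lra.
  rewrite exprS mulrA [Wk1 * _]mulrC.
  have p0 : 0 < (1 + del) ^+ k by rewrite exprn_gt0//; lra.
  have := ler_wpM2r (ltW p0) H.
  have : 0 <= k%:R * eps * del * (1 + del) ^+ k.
    by rewrite !mulr_ge0// ltW.
  by lra.
move=> t /andP[a_t tb].
have ta0 : 0 <= t - a by lra.
have /andP[kt tk] := truncn_itv ta0.
set k := Num.truncn (t - a) in kt tk.
have k0 : (0 : R) <= k%:R by [].
rewrite -natr1 in tk.
have kb : a + k%:R <= b by lra.
have ka : a <= a + k%:R by lra.
have H1 : W t <= W (a + k%:R) + eps by apply: mono => //; lra.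
have p0 : 0 < (1 + del) ^+ k by rewrite exprn_gt0//; lra.
have H2 : expR (eta * (t - a)) <= (1 + del) * (1 + del) ^+ k.
  by rewrite -exprS -expk ler_expR ler_wpM2l// -natr1; lra.
have H3 : (1 + del) ^+ k <= expR (eta * (b - a)).
  by rewrite -expk ler_expR ler_wpM2l//; lra.
have Wt := W0 t; have Wk := W0 (a + k%:R).
have WtE : 0 <= W t by apply: Wt; lra.
apply: (le_trans (ler_wpM2l WtE H2)).
rewrite mulrCA ler_pM2l; last lra.
have H4 := step k kb.
apply: (le_trans (ler_wpM2r (ltW p0) H1)); rewrite mulrDl.
apply: (@le_trans _ _ (W a + eps * (k%:R + 1) * (1 + del) ^+ k)); first by lra.
rewrite lerD2l; apply: ler_pM => //.
- by rewrite mulr_ge0//; lra.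
- exact: ltW.
- by rewrite ler_wpM2l//; lra.
Qed.

End barrier.

(** * Occupancy states with finite support *)

Lemma eseries_finite_support (R : realType) (f : nat -> \bar R) (C : pred nat)
    (i K : nat) : (forall k, (K <= k)%N -> f k = 0%E) ->
  (\sum_(i <= k <oo | C k) f k = \sum_(i <= k < K | C k) f k)%E.
Proof.
move=> f0; apply: lim_near_cst => //.
exists (maxn i K) => // n /=; rewrite geq_max => /andP[i_n Kn].
have [iK|Ki] := leqP i K.
  rewrite (big_cat_nat iK Kn)//= [X in (_ + X)%E](_ : _ = 0%E) ?adde0//.
  rewrite big_nat_cond big1//.
  by move=> k /andP[/andP[Kk _] _]; exact: f0.
rewrite (big_geq (ltnW Ki)) big_nat_cond big1// => k /andP[/andP[ik _] _].
by apply: f0; exact: leq_trans (ltnW Ki) ik.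
Qed.

Section states.
Context {R : realType} {r : nat}.
Variables (nu : nat -> profile r) (idx : profile r -> nat) (K : nat).
Hypotheses (nuK : cancel nu idx) (idxK : cancel idx nu).
Implicit Type s : profile r -> R.

Lemma simplex_series s : simplex s -> (\sum_(k <oo) (s (nu k))%:E)%E = 1%E.
Proof.
move=> [s01 s1].
have s0 v : (0 <= (s v)%:E)%E by rewrite lee_fin; case/andP: (s01 v).
rewrite nneseries_esumT// -s1; apply/esym.
apply: (@reindex_esum _ _ _ setT setT nu (fun v => (s v)%:E)).
by split => // [i j _ _ /(can_inj nuK)//|v _]; exists (idx v).
Qed.

Lemma simplex_sum s : (forall k, (K <= k)%N -> s (nu k) = 0) -> simplex s ->
  \sum_(0 <= k < K) s (nu k) = 1.
Proof.
move=> sK /simplex_series; rewrite (@eseries_finite_support _ _ _ _ K) => [|k Kk].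
  by rewrite sumEFin => -[].
by rewrite sK.
Qed.

Lemma simplex_support s : simplex s -> \sum_(0 <= k < K) s (nu k) = 1 ->
  forall k, (K <= k)%N -> s (nu k) = 0.
Proof.
move=> sS s1 k Kk; have := simplex_series sS.
have s0 j : (0 <= (s (nu j))%:E)%E by rewrite lee_fin; case/andP: (sS.1 (nu j)).
rewrite (nneseries_split 0 k.+1)// add0n => H.
have : (\sum_(0 <= j < k.+1) (s (nu j))%:E <= 1)%E.
  by rewrite -H leeDl// nneseries_ge0.
rewrite sumEFin lee_fin big_nat_recr//= (big_cat_nat _ Kk)//= s1 => H1.
apply/eqP; rewrite eq_le; have -> : 0 <= s (nu k) by have := s0 k; rewrite lee_fin.
rewrite andbT; have : 0 <= \sum_(K <= j < k) s (nu j).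
  by apply: sumr_ge0 => j _; have := s0 j; rewrite lee_fin.
by lra.
Qed.

Section finite_state.
Variable s : profile r -> R.
Hypothesis sK : forall k, (K <= k)%N -> s (nu k) = 0.
Hypothesis s_ge0 : forall v, 0 <= s v.
Hypothesis s_sum : \sum_(0 <= k < K) s (nu k) = 1.

Lemma tail_sumE (C : pred nat) i :
  tail_sum nu s C i = \sum_(i <= k < K | C k) s (nu k).
Proof.
rewrite /tail_sum (@eseries_finite_support _ _ _ _ K) ?sumEFin// => k Kk.
by rewrite sK.
Qed.

Lemma qE j : q nu s j = \sum_(0 <= k < K | (j <= ntasks (nu k))%N) s (nu k).
Proof. by rewrite /q tail_sumE. Qed.

Lemma q_compl j :
  1 - q nu s j = \sum_(0 <= k < K | (ntasks (nu k) < j)%N) s (nu k).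
Proof.
rewrite qE -s_sum [X in X - _](bigID (fun k => (j <= ntasks (nu k))%N))/= addrC addrK.
by apply: eq_bigl => k; rewrite -ltnNge.
Qed.

Lemma q_le1 j : q nu s j <= 1.
Proof. by rewrite -subr_ge0 q_compl sumr_ge0. Qed.

Lemma excess_sum h (c : R) :
  (\sum_(0 <= i <oo | (h < i)%N) (q nu s i * c)%:E)%E =
  ((\sum_(0 <= k < K) (ntasks (nu k) - h)%N%:R * s (nu k)) * c)%:E.
Proof.
pose M := (\max_(k < K) ntasks (nu k))%N.
have nM k : (k < K)%N -> (ntasks (nu k) <= M)%N.
  by move=> kK; exact: (leq_bigmax (Ordinal kK)).
rewrite (@eseries_finite_support _ _ _ _ M.+1); last first.
  move=> i Mi; rewrite qE big_nat_cond big1 ?mul0r// => k /andP[/andP[_ kK] ik].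
  by have := leq_trans Mi (leq_trans ik (nM _ kK)); rewrite ltnn.
rewrite sumEFin; congr EFin; rewrite -mulr_suml; congr (_ * _).
under eq_bigr do rewrite qE big_mkcond.
rewrite exchange_big/= !big_nat; apply: eq_bigr => k /andP[_ kK].
rewrite -big_mkcondr/=.
have -> : (ntasks (nu k) - h)%N%:R * s (nu k) =
    \sum_(h.+1 <= i < (ntasks (nu k)).+1) s (nu k).
  by rewrite big_const_nat iter_addr_0 subSS mulr_natl.
rewrite [RHS](@big_nat_widenl _ _ _ _ 0%N)//.
rewrite [RHS](@big_nat_widen _ _ _ _ _ M.+1) ?ltnS ?nM//.
Qed.

Lemma uE : u nu s = \sum_(0 <= k < K) (ntasks (nu k))%:R * s (nu k).
Proof.
have := excess_sum 0 1; rewrite mulr1.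
under [X in _ = X%:E -> _]eq_bigr do rewrite subn0.
move=> E; rewrite /u; suff -> : (\sum_(1 <= i <oo) (q nu s i)%:E)%E =
    (\sum_(0 <= i <oo | (0 < i)%N) (q nu s i * 1)%:E)%E by rewrite E.
apply: congr_lim; apply/funext => n /=.
rewrite (@big_nat_widenl _ _ _ _ 0%N)//; apply: eq_bigr => i _.
by rewrite mulr1.
Qed.

(** The intervals are consecutive, so that the indicator of each of them telescopes. *)
Lemma J_memE j k x : q nu s j < 1 ->
  let C k := (ntasks (nu k) < j)%N in
  let g i := 1 - (\sum_(i <= k < K | C k) s (nu k)) / (1 - q nu s j) in
  \1_(J_ nu s k j) x = ((x < g k.+1)%R%:R - (x < g k)%R%:R : R).
Proof.
move=> q1 C g; rewrite indicE /J_ q1 mem_setE in_itv/= !tail_sumE -/(g k) -/(g k.+1).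
have gk : g k <= g k.+1.
  rewrite /g lerB// ler_pM2r ?invr_gt0 ?subr_gt0//.
  have [kK|Kk] := ltnP k K; last by rewrite !big_geq// leqW.
  rewrite [leRHS]big_mkcond big_ltn//= -big_mkcond/= lerDr.
  by case: ifP.
case: (leP (g k) x) => h1 /=; first by rewrite subr0.
by rewrite (lt_le_trans h1 gk) subrr.
Qed.

Lemma J_partition j x : q nu s j < 1 -> 0 <= x < 1 ->
  \sum_(0 <= k < K) \1_(J_ nu s k j) x = 1 :> R.
Proof.
move=> q1 /andP[x0 x1].
under eq_bigr do rewrite J_memE//.
rewrite telescope_sumr// big_geq// mul0r subr0 x1.
by rewrite -q_compl divff ?subrr ?ltNge ?x0 ?subr0// gt_eqF// subr_gt0.
Qed.

Lemma J_null j k x : ((j <= ntasks (nu k))%N \/ s (nu k) = 0) ->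
  \1_(J_ nu s k j) x = 0 :> R.
Proof.
move=> H; have [q1|q1] := ltP (q nu s j) 1; last first.
  by rewrite /J_ ltNge q1/= indic0.
rewrite J_memE//; apply/eqP; rewrite subr_eq0; apply/eqP.
congr (nat_of_bool (_ < 1 - _ / _))%:R.
have [kK|Kk] := ltnP k K; last by rewrite !big_geq// leqW.
rewrite [RHS]big_mkcond [RHS]big_ltn//= -big_mkcond/=.
case: H => [|->]; first by rewrite leqNgt => /negbTE ->; rewrite add0r.
by case: ifP; rewrite add0r.
Qed.

Section dispatch.
Variables (Delta l : nat) (x : R).
Hypothesis x01 : 0 <= x < 1.
Hypothesis qh : q nu s (l + Delta) < 1.

Lemma dispatch_full k : (l + Delta <= ntasks (nu k))%N ->
  dispatch nu Delta s l k x = 0.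
Proof.
move=> h; rewrite /dispatch !ltnNge h (leq_trans (leq_addr _ _) h)/=.
by rewrite lt_eqF// mul0r.
Qed.

Lemma dispatch_low k : q nu s l < 1 -> (l <= ntasks (nu k))%N ->
  dispatch nu Delta s l k x = 0.
Proof.
move=> ql h; have [hk|hk] := leqP (l + Delta) (ntasks (nu k)).
  exact: dispatch_full.
by rewrite /dispatch ltnNge h/= hk lt_eqF// mul0r.
Qed.

(** The branches of the dispatching rule amount to a single partition of the unit
interval: if every pool has l tasks or more, the profiles with fewer than l tasks
carry no mass and their intervals are empty. *)
Lemma dispatchE k : dispatch nu Delta s l k x =
  \1_(J_ nu s k (if q nu s l < 1 then l else (l + Delta)%N)) x.
Proof.
case: ifPn => [ql|]; last rewrite -leNgt => ql.
  have [lk|kl] := leqP l (ntasks (nu k)); last by rewrite /dispatch kl.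
  by rewrite dispatch_low// J_null//; left.
have [hk|kh] := leqP (l + Delta) (ntasks (nu k)).
  by rewrite dispatch_full// J_null//; left.
have q1 : q nu s l = 1 by apply/eqP; rewrite eq_le q_le1.
rewrite /dispatch kh; case: ifPn => [kl|_]; last by rewrite q1 eqxx mul1r.
rewrite /J_ q1 ltxx indic0 -/(J_ nu s k (l + Delta)) J_null//; right.
have [kK|/sK//] := ltnP k K.
have := q_compl l; rewrite q1 subrr => /esym/eqP.
rewrite psumr_eq0// => /allP/(_ k); rewrite mem_index_iota kK => /(_ isT).
by rewrite kl => /eqP.
Qed.

Lemma dispatch_sum : \sum_(0 <= k < K) dispatch nu Delta s l k x = 1.
Proof.
under eq_bigr do rewrite dispatchE.
by apply: J_partition => //; case: ifP.
Qed.

End dispatch.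
End finite_state.
End states.

(** * Time integrals of right-continuous paths *)

Section paths.
Context {R : realType}.

(** The path is the pointwise limit of its values at the next point of a grid, from
the right. *)
Lemma right_continuous_measurable (f : R -> R) (T : R) :
  (forall t, 0 <= t < T -> f x @[x --> t^'+] --> f t) ->
  measurable_fun `[0, T] f.
Proof.
move=> fc.
have mI : measurable_fun `[0, T[ f.
  (* The grid point is strictly larger than x, so that right limits apply. *)
  pose h (k : nat) (x : R) := f ((Num.truncn (k.+1%:R * x)).+1%:R / k.+1%:R).
  have h_cvg (x : R) : 0 <= x < T -> h ^~ x @ \oo --> f x.
    move=> /andP[x0 xT].
    have H := fc x; rewrite x0 xT in H; have {}H := H isT.
    apply: cvg_comp H => /=.
    move=> P [e /= e0 HP].
    have [k0 _ Hk0] := nbhs_infty_gtr e^-1.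
    exists k0 => // k k0k /=; apply: HP => /=.

      have kx0 : 0 <= k.+1%:R * x by rewrite mulr_ge0.
      have /andP[h1 h2] := truncn_itv kx0.
      have k10 : (0 : R) < k.+1%:R by [].
      have h3 : e^-1 < k.+1%:R by apply: Hk0 => /=; exact: leqW.
      set z := _.+1%:R / _.
      have h4 : x < z by rewrite /z ltr_pdivlMr// mulrC.
      have h5 : z <= x + k.+1%:R^-1.
        by rewrite /z ler_pdivrMr// mulrDl mulVf ?gt_eqF// -[_.+1%:R in leLHS]natr1 lerD2r [x * _]mulrC.
      have h6 : k.+1%:R^-1 < e by rewrite invf_plt.
      rewrite ltr_norml; apply/andP; split.
        by rewrite ltrBrDl ltrBlDr (le_lt_trans h5)// ltrD2l.
      by rewrite ltrBlDl (lt_trans h4)// ltrDl.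
    have kx0 : 0 <= k.+1%:R * x by rewrite mulr_ge0.
    have /andP[h1 h2] := truncn_itv kx0.
    by rewrite ltr_pdivlMr// mulrC.
  apply: (@measurable_fun_cvg _ _ _ _ h) => [k _ Y mY|x /=]; last first.
    by rewrite in_itv/=; exact: h_cvg.
  rewrite [X in measurable X](_ : _ = \bigcup_(i in [set i | Y (f (i.+1%:R / k.+1%:R))])
     (`[0, T[ `&` `[i%:R / k.+1%:R, i.+1%:R / k.+1%:R[%classic)).
    by apply: bigcup_measurable => i _; exact: measurableI.
  apply/seteqP; split => x /=.
    rewrite in_itv/= => -[/andP[x0 xT] hx].
    have kx0 : 0 <= k.+1%:R * x by rewrite mulr_ge0.
    have /andP[h1 h2] := truncn_itv kx0.
    exists (Num.truncn (k.+1%:R * x)) => //; split; rewrite /= in_itv/= ?x0//.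
    by rewrite ler_pdivrMr// ltr_pdivlMr// [x * _]mulrC h1.
  move=> [i /= Yi []]; rewrite !in_itv/= => xT.
  rewrite ler_pdivrMr// ltr_pdivlMr// => /andP[h1 h2]; split => //.
  rewrite /h; suff -> : Num.truncn (k.+1%:R * x) = i by [].
  by apply: truncn_def; rewrite mulrC h1.
have [T0|T0] := ltP T 0.
  by rewrite set_itv_ge ?bnd_simp ?leNgt ?T0//; exact: measurable_fun_set0.
rewrite -(@setUitv1 _ _ (BLeft 0) T true) ?bnd_simp//; apply/measurable_funU => //; split => //.
exact: measurable_fun_set1.
Qed.

Variables (T : R) (f : nat -> R -> R).
Hypothesis f_rc : forall k t, 0 <= t < T -> f k x @[x --> t^'+] --> f k t.
Hypothesis f01 : forall k t, 0 <= t <= T -> 0 <= f k t <= 1.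

Local Notation mu := (@lebesgue_measure R).
Local Notation Th k t := (\int[mu]_(x in `[0, t]) f k x).

Lemma path_integrable k (D : interval R) : [set` D] `<=` `[0, T] ->
  mu.-integrable [set` D] (EFin \o f k).
Proof.
move=> DT; apply: measurable_bounded_integrable => //.
- apply: (@le_lt_trans _ _ (mu `[0, T]%classic)).
    by apply: le_measure; rewrite ?inE//; exact: measurable_itv.
  by rewrite lebesgue_measure_itv/=; case: ifP => // _; rewrite -EFinD ltry.
- apply: measurable_funS DT _ => //.
  by apply: right_continuous_measurable => t; exact: f_rc.
- exists 1; split => // M M1 x /DT /=; rewrite in_itv/= => xT.
  have /andP[h0 h1] := f01 k xT; rewrite ger0_norm//.
  exact: le_trans h1 (ltW M1).
Qed.

Lemma integral_comb (K : nat) (c : nat -> R) (D : interval R) :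
  [set` D] `<=` `[0, T] ->
  mu.-integrable [set` D] (EFin \o (fun x => \sum_(0 <= k < K) c k * f k x)) /\
  \int[mu]_(x in [set` D]) (\sum_(0 <= k < K) c k * f k x) =
  \sum_(0 <= k < K) c k * \int[mu]_(x in [set` D]) f k x.
Proof.
move=> DT; elim: K => [|K [IH1 IH2]].
  split.
    apply: (eq_integrable _ (cst 0%E)) => //; last exact: integrable0.
    by move=> x _ /=; rewrite big_geq.
  rewrite big_geq//; under eq_Rintegral do rewrite big_geq//.
  by rewrite Rintegral_cst// mul0r.
have iK : mu.-integrable [set` D] (EFin \o (fun x => c K * f K x)).
  refine (@integrableZl _ _ _ _ _ _ (c K) _ (path_integrable K DT)).
  exact: measurable_itv.
have E x : \sum_(0 <= k < K.+1) c k * f k x =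
   \sum_(0 <= k < K) c k * f k x + c K * f K x by rewrite big_nat_recr.
split.
  have -> : EFin \o (fun x => \sum_(0 <= k < K.+1) c k * f k x) =
      ((EFin \o (fun x => \sum_(0 <= k < K) c k * f k x)%R) \+
       (EFin \o (fun x => c K * f K x)%R))%E by apply/funext => x /=; rewrite E.
  refine (@integrableD _ _ _ _ _ _ _ _ IH1 iK).
  exact: measurable_itv.
rewrite big_nat_recr//= -IH2 -RintegralZl//; last exact: path_integrable.
rewrite -RintegralD//; apply: eq_Rintegral => x _; exact: E.
Qed.

(** The barriers have constant speeds, so that every drift is compared with a
constant. *)
Lemma integral_increment_le (K : nat) (c : nat -> R) (a b kap : R) :
  0 <= a -> a <= b -> b <= T ->
  (forall x, a < x <= b -> \sum_(0 <= k < K) c k * f k x <= kap) ->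
  \sum_(0 <= k < K) c k * (Th k b - Th k a) <= kap * (b - a).
Proof.
move=> a0 ab bT Hk.
have DT : [set` `]a, b]] `<=` `[0, T].
  move=> x /=; rewrite !in_itv/= => /andP[ax xb].
  by rewrite (le_trans a0 (ltW ax)) (le_trans xb bT).
have bT' : [set` `[0, b]] `<=` `[0, T].
  by move=> x /=; rewrite !in_itv/= => /andP[-> xb]; rewrite (le_trans xb bT).
have -> : \sum_(0 <= k < K) c k * (Th k b - Th k a) =
    \sum_(0 <= k < K) c k * \int[mu]_(x in [set` `]a, b]]) f k x.
  apply: eq_bigr => k _; congr (_ * _).
  by rewrite Rintegral_itvB//; exact: path_integrable.
have [iD <-] := integral_comb K c DT.
apply: (@le_trans _ _ (\int[mu]_(x in [set` `]a, b]]) kap)).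
  apply: le_Rintegral => //.
    apply: measurable_bounded_integrable => //.
      by rewrite [X in (X < _)%E]lebesgue_measure_itv/=; case: ifP => // _; rewrite -EFinD ltry.
    exact: bounded_cst.
rewrite Rintegral_cst// [X in fine X]lebesgue_measure_itv/= lte_fin.
case: ltP => //= h; have -> : b = a by apply/eqP; rewrite eq_le h ab.
by rewrite subrr !mulr0.
Qed.

Lemma integral_bounds k t : 0 <= t <= T -> 0 <= Th k t <= t.
Proof.
move=> /andP[t0 tT].
have tT' : [set` `[0, t]] `<=` `[0, T].
  by move=> x /=; rewrite !in_itv/= => /andP[-> xb]; rewrite (le_trans xb tT).
apply/andP; split.
  apply: Rintegral_ge0 => x /tT'/=; rewrite in_itv/= => xT.
  by have /andP[] := f01 k xT.
apply: (@le_trans _ _ (\int[mu]_(x in [set` `[0, t]]) 1)).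
  apply: le_Rintegral => //.
  - exact: path_integrable.
  - apply: measurable_bounded_integrable => //.
      by rewrite [X in (X < _)%E]lebesgue_measure_itv/=; case: ifP => // _; rewrite -EFinD ltry.
    exact: bounded_cst.
  - by move=> x /tT'/=; rewrite in_itv/= => h; have /andP[] := f01 k h.
rewrite Rintegral_cst// [X in fine X]lebesgue_measure_itv/= lte_fin mul1r.
by case: ifP => //=; rewrite subr0.
Qed.

Lemma integral_vanish k t : 0 <= t <= T -> (forall x, 0 <= x < t -> f k x = 0) ->
  Th k t = 0.
Proof.
move=> /andP[t0 tT] f0.
rewrite -Rintegral_itv_bndo_bndc; last first.
  apply: path_integrable => x /=; rewrite !in_itv/= => /andP[-> xt].
  by rewrite (le_trans (ltW xt)).
rewrite (@eq_Rintegral _ _ _ _ _ (cst 0)); last first.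
  by move=> x; rewrite inE/= in_itv/= => /f0.
by rewrite Rintegral_cst// mul0r.
Qed.

End paths.

(** * Discrete limits and jump times *)

Section discrete_limits.
Context {R : realType}.

Lemma nat_limit (F : set_system R) {FF : Filter F} (f : R -> nat) (a : nat) :
  f x @[x --> F] --> a -> \forall x \near F, f x = a.
Proof. by move=> h; apply: (h [set a]); rewrite nbhs_principalE; exact/principal_filterP. Qed.

(** Two multiples of 1 / n that are close are equal. *)
Lemma discrete_limit (F : set_system R) {FF : ProperFilter F} (n : nat)
    (f : R -> R) (a : R) : (0 < n)%N ->
  f x @[x --> F] --> a -> (\forall x \near F, n%:R * f x \is a Num.int) ->
  \forall x \near F, f x = a.
Proof.
move=> n0 fa fint.
have n0' : 0 < n%:R :> R by rewrite ltr0n.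
(* Values within e of the limit are within 1 / n of each other. *)
pose e : R := (2 * n%:R)^-1.
have e0 : 0 < e by rewrite invr_gt0 mulr_gt0.
have ne : n%:R * e = 2^-1 by rewrite /e invfM mulrCA divff ?mulr1// gt_eqF.
have close : \forall x \near F, `|a - f x| < e by move/cvgrPdist_lt : fa; apply.
have [x0 [I0 C0]] := @filter_ex _ F _ _ (filterI fint close).
have const : \forall x \near F, f x = f x0.
  apply: filterS2 fint close => x Ix Cx.
  have : n%:R * f x - n%:R * f x0 \is a Num.int by rewrite rpredB.
  move=> /intrP[z Ez].
  have : `|n%:R * f x - n%:R * f x0| < 1.
    rewrite -mulrBr normrM ger0_norm ?(ltW n0')// mulrC -ltr_pdivlMr// mul1r.
    have -> : n%:R^-1 = e + e :> R by rewrite /e invfM; field; rewrite gt_eqF.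
    rewrite (_ : f x - f x0 = (a - f x0) - (a - f x)); last by ring.
    by rewrite (le_lt_trans (ler_normB _ _))// ltrD.
  rewrite Ez -intr_norm ltrz1 => z1.
  have z0 : z = 0 by move: z1; clear; lia.
  move: Ez; rewrite z0 => /eqP; rewrite subr_eq0 => /eqP/(mulfI _); apply.
  by rewrite gt_eqF.
have -> : a = f x0; last by [].
apply: (@cvg_unique _ _ (f x @[x --> F])) => //.
by apply: cvg_near_cst; apply: filterS const => x ->.
Qed.

End discrete_limits.

Section jump_times.
Context {R : realType} {r : nat}.
Variables (lambda : R) (N : clock r -> R -> nat) (n : nat).
Hypothesis lambda_ge0 : 0 <= lambda.
Hypothesis N0 : forall c, N c 0 = 0%N.
Hypothesis Nmono : forall c t u, 0 <= t -> t <= u -> (N c t <= N c u)%N.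
Hypothesis Nrc : forall c t, 0 <= t -> N c x @[x --> t^'+] --> N c t.

Local Notation arr := (arrivals lambda N n).
Local Notation tau := (jump_time lambda N n).

Lemma arrivals0 : arr 0 = 0%N.
Proof. by rewrite /arrivals mulr0 N0. Qed.

Lemma arrivals_mono t u : 0 <= t -> t <= u -> (arr t <= arr u)%N.
Proof.
move=> t0 tu; apply: Nmono; first by rewrite !mulr_ge0.
by rewrite ler_wpM2l// mulr_ge0.
Qed.

(** The counts are integers, so that right-continuity means local constancy. *)
Lemma arrivals_rc t : 0 <= t -> \forall x \near t^'+, arr x = arr t.
Proof.
move=> t0; have := mulr_ge0 (ler0n _ n) lambda_ge0.
rewrite le_eqVlt => /predU1P[c0|c0].
  by apply: nearW => x; rewrite /arrivals -c0 !mul0r.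
have ct0 : 0 <= n%:R * lambda * t by rewrite mulr_ge0// ltW.
have [e /= e0 He] := nat_limit (@Nrc (arrival_clock r) _ ct0).
exists (e / (n%:R * lambda)) => [|x /=]; first by rewrite /= divr_gt0.
rewrite ltr_pdivlMr// => h tx; apply: He => /=; last by rewrite ltr_pM2l.
by rewrite -mulrBr normrM (gtr0_norm c0) mulrC.
Qed.

Section jump.
Variables (j : nat) (t : R).
Hypotheses (j_gt0 : (0 < j)%N) (t_ge0 : 0 <= t) (jt : (j <= arr t)%N).

Let S := [set t | 0 <= t /\ (j <= arr t)%N].

Let S_lb : has_lbound S. Proof. by exists 0 => x []. Qed.

Lemma jump_time_le : tau j <= t.
Proof. by apply: inf_lbound. Qed.

Lemma jump_time_ge0 : 0 <= tau j.
Proof. by apply: lb_le_inf; [exists t | move=> x []]. Qed.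

Lemma at_jump : (j <= arr (tau j))%N.
Proof.
have [e /= e0 He] := arrivals_rc jump_time_ge0.
have infS : has_inf S by split; [exists t|].
have [x [x0 jx] xtau] := inf_adherent e0 infS.
have tx : tau j <= x by apply: inf_lbound.
move: tx; rewrite le_eqVlt => /predU1P[->//|tx].
rewrite -(He x)//=; rewrite distrC gtr0_norm ?subr_gt0//.
by rewrite ltrBlDl.
Qed.

Lemma jump_time_gt0 : 0 < tau j.
Proof.
rewrite lt_neqAle jump_time_ge0 andbT; apply/eqP => h.
by move: at_jump; rewrite -h arrivals0 leqNgt j_gt0.
Qed.

Lemma jump_time_gt x : 0 <= x -> (arr x < j)%N -> x < tau j.
Proof.
move=> x0; apply: contraTT; rewrite -leqNgt -leNgt => h.
by rewrite (leq_trans at_jump)// arrivals_mono// jump_time_ge0.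
Qed.

End jump.
End jump_times.

(** * Profiles and transitions between them *)

Section profiles.
Context {r : nat}.
Implicit Types (v : profile r) (m : 'I_r.+1).

Definition move v (m : 'I_r) : profile r := decr (incr v (tgt m)) (src m).

Lemma src_neq_tgt (m : 'I_r) : (src m == tgt m) = false.
Proof. by apply/negP => /eqP/(congr1 val)/=; rewrite /bump/=; lia. Qed.

Lemma ntasks_incr v m : ntasks (incr v m) = (ntasks v).+1.
Proof.
rewrite /ntasks (bigD1 m)//= [in RHS](bigD1 m)//= ffunE eqxx addn1 addSn.
by congr (_ + _).+1; apply: eq_bigr => k /negbTE km; rewrite ffunE km addn0.
Qed.

Lemma incrK v m : decr (incr v m) m = v.
Proof. by apply/ffunP => k; rewrite !ffunE addnK. Qed.

Lemma decrK v m : v m != 0%N -> incr (decr v m) m = v.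
Proof.
move=> vm; apply/ffunP => k; rewrite !ffunE subnK//.
by case: eqP => [->|//]; rewrite lt0n.
Qed.

Lemma ntasks_decr v m : v m != 0%N -> (ntasks (decr v m)).+1 = ntasks v.
Proof. by move=> vm; rewrite -(ntasks_incr _ m) decrK. Qed.

Lemma ntasks_move v (m : 'I_r) : v (src m) != 0%N -> ntasks (move v m) = ntasks v.
Proof.
move=> vm; apply: succn_inj; rewrite ntasks_decr ?ntasks_incr//.
by rewrite ffunE src_neq_tgt addn0.
Qed.

Lemma moveK v (m : 'I_r) : v (src m) != 0%N ->
  decr (incr (move v m) (src m)) (tgt m) = v.
Proof.
move=> vm; rewrite decrK ?incrK//.
by rewrite ffunE src_neq_tgt addn0.
Qed.

Lemma unmoveK v (m : 'I_r) : v (tgt m) != 0%N ->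
  move (decr (incr v (src m)) (tgt m)) m = v.
Proof.
move=> vm; rewrite /move decrK ?incrK//.
by rewrite ffunE [tgt m == _]eq_sym src_neq_tgt addn0.
Qed.

Lemma exists_profile_bound (idx : profile r -> nat) (M : nat) :
  exists K, forall v, (ntasks v <= M)%N -> (idx v < K)%N.
Proof.
exists (\max_(f : {ffun 'I_r.+1 -> 'I_M.+1}) idx [ffun m => nat_of_ord (f m)]).+1.
move=> v vM; rewrite ltnS.
have vm m : (v m < M.+1)%N.
  by rewrite ltnS (leq_trans _ vM)// /ntasks (bigD1 m)//= leq_addr.
apply: (leq_trans _ (leq_bigmax (finfun (fun m => Ordinal (vm m))))).
by rewrite eq_leq//; congr idx; apply/ffunP => m; rewrite !ffunE.
Qed.

End profiles.

Section transfer.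
Context {R : realType} {r : nat}.
Variables (nu : nat -> profile r) (idx : profile r -> nat) (K : nat).
Hypotheses (nuK : cancel nu idx) (idxK : cancel idx nu).

Lemma sum_pick (a : nat -> R) (v : profile r) : (idx v < K)%N ->
  \sum_(0 <= k < K) a k * (nu k == v)%:R = a (idx v).
Proof.
move=> vK; rewrite (bigD1_seq (idx v)) ?iota_uniq ?mem_index_iota//=.
rewrite idxK eqxx mulr1 big1_seq ?addr0// => k /andP[kv _].
case: eqP => [kv'|]; rewrite ?mulr0//.
by rewrite -kv' nuK eqxx in kv.
Qed.

(** Mass that flows out of w along the transition g reaches g w. The source of the
flow into v is recovered by h, when cod v says that it exists. *)
Lemma transfer (phi : profile r -> R) (F : profile r -> R) (g h : profile r -> profile r)
    (cod : pred (profile r)) :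
  (forall v, cod v -> g (h v) = v) ->
  (forall w, F w != 0 ->
     [/\ cod (g w), h (g w) = w, (idx w < K)%N & (idx (g w) < K)%N]) ->
  \sum_(0 <= k < K) phi (nu k) * (if cod (nu k) then F (h (nu k)) else 0) =
  \sum_(0 <= k < K) F (nu k) * phi (g (nu k)).
Proof.
move=> gh HF.
have E k : (if cod (nu k) then F (h (nu k)) else 0) =
    \sum_(0 <= i < K) F (nu i) * (nu k == g (nu i))%:R.
  have [F0|F1] := eqVneq (F (h (nu k))) 0.
    rewrite big1_seq; first by case: ifP.
    move=> i _; have [->|Fi] := eqVneq (F (nu i)) 0; first by rewrite mul0r.
    have [_ hg _ _] := HF _ Fi.
    case: eqP => [e|_]; last by rewrite mulr0.
    by move: Fi; rewrite -hg -e F0 eqxx.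
  have [c1 hg iK _] := HF _ F1.
  case: ifPn => [ck|nck].
    have := @sum_pick (fun i => F (nu i)) (h (nu k)) iK; rewrite /= idxK => <-.
    apply: eq_bigr => i _.
    have [->|Fi] := eqVneq (F (nu i)) 0; first by rewrite !mul0r.
    have [_ hgi _ _] := HF _ Fi.
    congr (_ * (nat_of_bool _)%:R); apply/eqP/eqP => [->|->]; first by rewrite gh.
    by rewrite hgi.
  rewrite big1_seq// => i _.
  have [->|Fi] := eqVneq (F (nu i)) 0; first by rewrite mul0r.
  have [ci _ _ _] := HF _ Fi.
  by case: eqP => [e|_]; rewrite ?mulr0//; rewrite -e (negbTE nck) in ci.
under eq_bigr do rewrite E mulr_sumr.
rewrite exchange_big/=; apply: eq_bigr => i _.
have [->|Fi] := eqVneq (F (nu i)) 0.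
  by rewrite mul0r big1_seq// => k _; rewrite mul0r mulr0.
have [_ _ _ gK] := HF _ Fi.
under eq_bigr do rewrite mulrCA.
by rewrite -mulr_sumr sum_pick ?idxK.
Qed.

End transfer.

(** * The equilibrium of the phases *)

Section equilibrium.
Context {R : realType} {r : nat}.
Variables (lambda : R) (mu p : 'I_r.+1 -> R).

Definition inflow (y : 'I_r.+1 -> R) (m : 'I_r.+1) : R :=
  (m == ord0)%:R * lambda +
  \sum_(i < r) p (src i) * mu (src i) * y (src i) * (m == tgt i)%:R.

Definition equil (m : 'I_r.+1) : R :=
  lambda * (\prod_(j < r.+1 | (j < m)%N) p j) / mu m.

Lemma inflow0 y : inflow y ord0 = lambda.
Proof.
rewrite /inflow eqxx mul1r big1 ?addr0// => i _.
by rewrite -val_eqE /= mulr0.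
Qed.

Lemma inflow_tgt y i : inflow y (tgt i) = p (src i) * mu (src i) * y (src i).
Proof.
rewrite /inflow -val_eqE/= mul0r add0r (bigD1 i)//= eqxx mulr1 big1 ?addr0// => k ki.
by rewrite (inj_eq lift_inj) eq_sym (negbTE ki) mulr0.
Qed.

Lemma phase_cases (m : 'I_r.+1) : m = ord0 \/ exists i, m = tgt i.
Proof.
case: (unliftP ord0 m) => [i ->|->]; [right|by left].
by exists i.
Qed.

Hypothesis mu_gt0 : forall m, 0 < mu m.

Lemma equil_tgt i : mu (tgt i) * equil (tgt i) = p (src i) * mu (src i) * equil (src i).
Proof.
have mu1 := lt0r_neq0 (mu_gt0 (tgt i)); have mu2 := lt0r_neq0 (mu_gt0 (src i)).
rewrite /equil (bigD1 (src i))/=; last by rewrite /bump leq0n add1n.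
have -> : \prod_(j < r.+1 | (j < tgt i)%N && (j != src i)) p j =
    \prod_(j < r.+1 | (j < src i)%N) p j.
  apply: eq_bigl => j; rewrite -val_eqE/= /bump leq0n add1n; lia.
by field; rewrite mu1 mu2.
Qed.

Lemma equil0 : mu ord0 * equil ord0 = lambda.
Proof.
rewrite /equil big_pred0 ?mulr1 1?mulrC ?divfK//.
by rewrite lt0r_neq0.
Qed.

Hypothesis p_last : p ord_max = 0.

(** The probability of reaching phase k, with phases counted from 0. *)
Let survival (k : nat) : R := \prod_(j < r.+1 | (j < k)%N) p j.

Let survivalS (m : 'I_r.+1) : (1 - p m) * survival m = survival m - survival m.+1.
Proof.
suff -> : survival m.+1 = p m * survival m by ring.
rewrite /survival (bigD1 m)//=; congr (_ * _); apply: eq_bigl => j.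
by rewrite -val_eqE/=; lia.
Qed.

Let survival_sum (k : 'I_r.+1) :
  \sum_(i < r.+1 | (k <= i)%N) (1 - p i) * survival i = survival k.
Proof.
under eq_bigr do rewrite survivalS.
rewrite -(big_mkord (fun i => k <= i)%N (fun i => survival i - survival i.+1)).
have -> : \sum_(0 <= i < r.+1 | (k <= i)%N) (survival i - survival i.+1) =
   \sum_(k <= i < r.+1) (survival i - survival i.+1).
  by rewrite [RHS](@big_nat_widenl _ _ _ _ 0%N).
rewrite (telescope_sumr_eq (fun i => - survival i)) => [||i _]; last by ring.
  rewrite [survival r.+1](bigD1 ord_max)//= p_last mul0r; ring.
exact: ltnW.
Qed.

(** The flow that reaches the last phase leaves it, so that everything that enters
leaves the system. *)
Lemma equil_departures : \sum_m (1 - p m) * mu m * equil m = lambda.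
Proof.
have -> : lambda = lambda * survival (@ord0 r).
  by rewrite /survival big_pred0 ?mulr1.
rewrite -survival_sum/= mulr_sumr; apply: eq_bigr => m _.
by rewrite /equil -/(survival m); field; rewrite gt_eqF.
Qed.

(** Exchanging the sums over the last phase reached and over the phases visited
turns the mean service time into a sum of mean times spent in each phase. *)
Lemma load_equil : load lambda mu p = \sum_m equil m.
Proof.
rewrite /load /mean_service mulr_sumr.
under eq_bigr do rewrite -/(survival _) mulr_sumr mulr_sumr big_mkcond.
rewrite exchange_big/=; apply: eq_bigr => k _.
rewrite /equil -/(survival k) -survival_sum -big_mkcond/= mulr_sumr mulr_suml.
by apply: eq_bigr => i _; rewrite mulrA.
Qed.

End equilibrium.

Section cascade.
Context {R : realType} {r : nat}.
Variables (lambda B : R) (mu p : 'I_r.+1 -> R).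
Hypotheses (lambda_ge0 : 0 <= lambda) (B_ge0 : 0 <= B).
Hypothesis mu_gt0 : forall m, 0 < mu m.
Hypothesis p01 : forall m, 0 <= p m <= 1.

Local Notation inflow := (inflow lambda mu p).
Local Notation equil := (equil lambda mu p).

Lemma equil_ge0 m : 0 <= equil m.
Proof.
rewrite /equil divr_ge0 ?(ltW (mu_gt0 m))// mulr_ge0//.
by apply: prodr_ge0 => j _; case/andP: (p01 j).
Qed.

(** The inequalities replace the integral equations satisfied in the limit by the
mean number of tasks in each phase; eps bounds the stochastic error on all time
intervals at once. *)
Record approx_system (y : 'I_r.+1 -> R -> R) (T C eps : R) : Prop := ApproxSystem {
  system_bound : forall m t, 0 <= t <= T -> 0 <= y m t <= C ;
  system_growth : forall m t, 0 <= t <= T -> y m t <= B + lambda * t + 1 ;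
  system_upper : forall m t u kap, 0 <= t -> t <= u -> u <= T ->
    (forall x, t < x <= u -> inflow (y ^~ x) m - mu m * y m x <= kap) ->
    y m u - y m t <= kap * (u - t) + eps ;
  system_lower : forall m t u kap, 0 <= t -> t <= u -> u <= T ->
    (forall x, t < x <= u -> kap <= inflow (y ^~ x) m - mu m * y m x) ->
    kap * (u - t) - eps <= y m u - y m t }.

(** Outside of a band of half-width alpha / 2 around equilibrium, the drift points
towards the band with speed at least kap = mu m * alpha / 4, because the inflow
is within kap of its equilibrium value. *)
Lemma relax y T C eps (m : 'I_r.+1) (alpha a : R) :
  0 < alpha -> 0 <= a -> 0 <= C -> eps <= alpha / 4 -> approx_system y T C eps ->
  (forall x, a <= x <= T -> 0 <= inflow (y ^~ x) m /\
     `|inflow (y ^~ x) m - mu m * equil m| <= mu m * alpha / 4) ->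
  forall t, a + (B + lambda * a + 1 + equil m) / (mu m * alpha / 4) <= t <= T ->
  `|y m t - equil m| <= alpha.
Proof.
move=> alpha0 a0 C0 epsa ys Hf t tT.
have m0 := mu_gt0 m; have e0 := equil_ge0 m.
set kap := mu m * alpha / 4; set K0 := B + lambda * a + 1 + equil m.
have kap0 : 0 < kap by rewrite divr_gt0// mulr_gt0.
have la0 : 0 <= lambda * a by exact: mulr_ge0.
have K00 : 0 <= K0 by rewrite /K0 !addr_ge0.
have aT : a <= T.
  move: tT => /andP[h1 h2]; apply: le_trans h2; apply: le_trans h1.
  by rewrite lerDl divr_ge0// ltW.
have aT' : 0 <= a <= T by rewrite a0.
have in_T x u v : a <= u -> v <= T -> u < x <= v -> a <= x <= T.
  by move=> au vT /andP[ux xv]; apply/andP; split; lra.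
have in_T0 x u v : a <= u -> v <= T -> u < x <= v -> 0 <= x <= T.
  by move=> au vT /andP[ux xv]; apply/andP; split; lra.
have E : mu m * (alpha / 2) = 2 * kap by rewrite /kap; field.
have up : y m t <= equil m + alpha / 2 + 2 * eps.
  apply: (@settle R (y m) a T (equil m + alpha / 2) K0 kap (mu m * equil m + kap) eps) => //.
  - by apply: addr_ge0; [apply: mulr_ge0 => //; exact: ltW|exact: ltW].
  - by have := system_growth ys m aT'; rewrite /K0; lra.
  - move=> u v au uv vT; apply: (system_upper ys) => // [|x xuv]; first exact: le_trans au.
    have [_] := Hf x (in_T _ _ _ au vT xuv); rewrite ler_norml => /andP[_].
    have /andP[y0 _] := system_bound ys m (in_T0 _ _ _ au vT xuv).
    have := mulr_ge0 (ltW m0) y0; rewrite -/kap; lra.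
  - move=> u v au uv vT above; apply: (system_upper ys) => // [|x xuv]; first exact: le_trans au.
    have [_] := Hf x (in_T _ _ _ au vT xuv); rewrite ler_norml => /andP[_].
    have := above x xuv; rewrite -(ltr_pM2l m0) mulrDr E -/kap; lra.
have low : - y m t <= - equil m + alpha / 2 + 2 * eps.
  apply: (@settle R (fun x => - y m x) a T (- equil m + alpha / 2) K0 kap (mu m * C) eps) => //.
  - by rewrite mulr_ge0// ltW.
  - by have /andP[y0 _] := system_bound ys m aT'; have := B_ge0; rewrite /K0; lra.
  - move=> u v au uv vT.
    have := @system_lower _ _ _ _ ys m u v (- (mu m * C)) (le_trans a0 au) uv vT.
    move=> h; have {}h : - (mu m * C) * (v - u) - eps <= y m v - y m u.
      apply: h => x xuv; have [f0 _] := Hf x (in_T _ _ _ au vT xuv).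
      have /andP[_ yC] := system_bound ys m (in_T0 _ _ _ au vT xuv).
      have : mu m * y m x <= mu m * C by rewrite ler_pM2l.
      by lra.
    by lra.
  - move=> u v au uv vT above.
    have := @system_lower _ _ _ _ ys m u v kap (le_trans a0 au) uv vT.
    move=> h; have {}h : kap * (v - u) - eps <= y m v - y m u.
      apply: h => x xuv.
      have [_] := Hf x (in_T _ _ _ au vT xuv); rewrite ler_norml => /andP[+ _].
      have := above x xuv; rewrite -(ltr_pM2l m0) mulrDr !mulrN E -/kap; lra.
    by lra.
by rewrite ler_norml; apply/andP; split; lra.
Qed.

(** Induction on the phase: the precision required for phase m determines the one
required earlier for the previous phase, from which the inflow comes. *)
Lemma cascade (m : 'I_r.+1) (alpha : R) : 0 < alpha ->
  exists sigma e0 : R, [/\ 0 <= sigma, 0 < e0 &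
    forall y T C eps, 0 <= C -> eps <= e0 -> approx_system y T C eps ->
    forall t, sigma <= t <= T -> `|y m t - equil m| <= alpha].
Proof.
move: {2}(nat_of_ord m) (erefl (nat_of_ord m)) => k.
elim: k m alpha => [|k IH] m alpha mk alpha0.
  have {mk} -> : m = ord0 by apply: val_inj.
  exists (0 + (B + lambda * 0 + 1 + equil ord0) / (mu ord0 * alpha / 4)), (alpha / 4).
  split; [|by rewrite divr_gt0|].
    rewrite add0r mulr0 addr0 divr_ge0//; first by rewrite !addr_ge0// equil_ge0.
    by rewrite divr_ge0// mulr_ge0// ltW.
  move=> y T C eps C0 epsa ys t tT.
  apply: (relax alpha0 (lexx 0) C0 epsa ys) tT => x _.
  rewrite inflow0 (equil0 _ _ mu_gt0) subrr normr0; split => //.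
  by rewrite divr_ge0// mulr_ge0// ltW.
have [m0|[i mi]] := phase_cases m; first by move: mk; rewrite m0.
have ik : nat_of_ord (src i) = k by move: mk; rewrite mi /= /bump/=; lia.
have mui := mu_gt0 (src i); have mum := mu_gt0 m.
(* Multiplied by the rate p (src i) * mu (src i) of the inflow, this is at most
   mu m * alpha / 4. *)
pose beta := mu m * alpha / (4 * mu (src i)).
have beta0 : 0 < beta by rewrite divr_gt0// mulr_gt0.
have [a [e1 [a0 e10 Ha]]] := IH (src i) beta ik beta0.
exists (a + (B + lambda * a + 1 + equil m) / (mu m * alpha / 4)), (Num.min e1 (alpha / 4)).
have tm0 : 0 <= (B + lambda * a + 1 + equil m) / (mu m * alpha / 4).
  rewrite divr_ge0//; first by rewrite !addr_ge0// ?equil_ge0// mulr_ge0.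
  by rewrite divr_ge0// mulr_ge0// ltW.
split; [by rewrite addr_ge0|by rewrite lt_min e10 divr_gt0|].
move=> y T C eps C0; rewrite le_min => /andP[eps1 epsa] ys t tT.
apply: (relax alpha0 a0 C0 epsa ys) tT => x xT.
have xT' : 0 <= x <= T by move: xT => /andP[ax ->]; rewrite (le_trans a0 ax).
have [p0 p1] := andP (p01 (src i)).
have [y0 _] := andP (system_bound ys (src i) xT').
rewrite mi inflow_tgt (equil_tgt _ _ mu_gt0) -mulrBr; split.
  by rewrite !mulr_ge0// ltW.
rewrite normrM ger0_norm ?mulr_ge0// ?(ltW mui)// -mi.
have h := Ha y T C eps C0 eps1 ys x xT.
apply: (@le_trans _ _ (1 * mu (src i) * beta)).
  by rewrite ler_pM// ?mulr_ge0 ?(ltW mui)// ler_pM2r.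
by rewrite mul1r /beta le_eqVlt; apply/orP; left; apply/eqP; field; rewrite gt_eqF.
Qed.

Lemma cascade_uniform (alpha : R) : 0 < alpha ->
  exists sigma e0 : R, [/\ 0 <= sigma, 0 < e0 &
    forall y T C eps, 0 <= C -> eps <= e0 -> approx_system y T C eps ->
    forall m t, sigma <= t <= T -> `|y m t - equil m| <= alpha].
Proof.
move=> alpha0.
have H m := cascade m alpha0.
have [sg /= Hs] := choice H.
have [ep /= He] := choice Hs.
have ep0 m : 0 < ep m by case: (He m).
exists (\sum_m sg m), (\big[Num.min/1]_m ep m).
have sg0 m : 0 <= sg m by case: (He m).
split; first by apply: sumr_ge0.
  by elim/big_ind : _ => // x y x0 y0; rewrite lt_min x0.
move=> y T C eps C0 epse ys m t /andP[st tT].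
have [_ _] := He m; apply; [exact: C0| |exact: ys|].
  by apply: (le_trans epse); rewrite (bigD1 m)//= ge_min lexx.
by rewrite tT andbT; apply: le_trans st; rewrite (bigD1 m)//= lerDl sumr_ge0.
Qed.

End cascade.

(** * Sample paths of one system *)

(** The supremum of the times up to which Q holds is reached, and cannot be passed
only if it is T. *)
Lemma real_induction (R : realType) (T : R) (Q : R -> Prop) :
  (forall t, 0 <= t <= T -> (forall x, 0 <= x < t -> Q x) -> Q t) ->
  (forall t, 0 <= t < T -> (forall x, 0 <= x <= t -> Q x) ->
     \forall x \near t^'+, Q x) ->
  forall t, 0 <= t <= T -> Q t.
Proof.
move=> Hl Hr.
suff H : forall t, 0 <= t <= T -> forall x, 0 <= x < t -> Q x.
  by move=> t tT; apply: Hl => //; exact: H.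
move=> t0 /andP[t00 t0T]; apply: contrapT => H.
pose S := [set t | 0 <= t <= T /\ forall x, 0 <= x < t -> Q x].
have S0 : S 0.
  split; first by rewrite lexx (le_trans t00 t0T).
  by move=> x /andP[x0 /(le_lt_trans x0)]; rewrite ltxx.
have supS : has_sup S by split; [exists 0|exists T => x [/andP[]]].
set b := sup S.
have b0 : 0 <= b by apply: ub_le_sup => //; exact: supS.2.
have bT : b <= T by apply: ge_sup; [exists 0|move=> x [/andP[]]].
have Qb x : 0 <= x < b -> Q x.
  move=> /andP[x0 xb].
  have bx : 0 < b - x by rewrite subr_gt0.
  have [y [_ Hy]] := sup_adherent bx supS.
  by rewrite subKr => xy; apply: Hy; rewrite x0.
have Qbb : forall x, 0 <= x <= b -> Q x.
  move=> x /andP[x0]; rewrite le_eqVlt => /predU1P[->|xb].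
    by apply: Hl; rewrite ?b0.
  by apply: Qb; rewrite x0.
have [bltT|Tb] := ltP b T; last first.
  apply: H => x /andP[x0 xt]; apply: Qbb; rewrite x0/=.
  by rewrite (le_trans (ltW xt))// (le_trans t0T).
have [e /= e0 He] : \forall x \near b^'+, Q x by apply: Hr => //; rewrite b0.
pose c := Num.min (b + e) T.
have bc : b < c by rewrite lt_min bltT ltrDl e0.
have Sc : S c.
  split; first by rewrite (le_trans b0 (ltW bc)) ge_min lexx orbT.
  move=> x /andP[x0 xc]; have [xb|bx] := leP x b; first by apply: Qbb; rewrite x0.
  apply: He => //=; rewrite distrC gtr0_norm ?subr_gt0// ltrBlDl.
  by rewrite (lt_le_trans xc)// ge_min lexx.
have : c <= b by apply: ub_le_sup => //; exact: supS.2.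
by rewrite leNgt bc.
Qed.

Lemma dispatch_int (R : realType) (r : nat) (nu : nat -> profile r) Delta
    (s : profile r -> R) l i x : dispatch nu Delta s l i x \is a Num.int.
Proof.
by rewrite /dispatch !indicE; case: ifP => _; [|case: ifP => _];
  rewrite ?rpredM ?intr_nat.
Qed.

Lemma floor_mul_bounds (R : realType) (Delta : nat) (x : R) : (0 < Delta)%N ->
  (floor_mul Delta x)%:~R <= x < (floor_mul Delta x)%:~R + Delta%:R.
Proof.
move=> D0; have [-> H] := floor_mul_max x D0.
rewrite /= ltNge; apply/negP => h.
have := H (Num.floor (x / Delta%:R) + 1).
rewrite mulrDl mul1r -/(floor_mul Delta x) intrD.
move=> /(_ h); rewrite gerDl; lia.
Qed.

Lemma subn_pred_eq0 a b : ~~ (b <= a)%N -> (a - b.-1 = 0)%N.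
Proof. lia. Qed.

Lemma subn_pred_le a b : (a - b.-1 <= a - b + 1)%N.
Proof. lia. Qed.

Lemma subn_decompS a b : (b < a)%N -> (a - b = (a - b.+1) + 1)%N.
Proof. lia. Qed.

Lemma subn_decomp_pred a b : (a < b)%N -> (b - a = (b.-1 - a) + 1)%N.
Proof. lia. Qed.

Section trajectory.
Context {R : realType} {r : nat}.
Variables (Delta : nat) (lambda : R) (mu p : 'I_r.+1 -> R).
Variables (nu : nat -> profile r) (idx : profile r -> nat).
Variables (N : clock r -> R -> nat) (U : nat -> R) (n : nat).
Variables (s : R -> profile r -> R) (l : R -> nat) (T : R).
Variable s_init : profile r -> R.
Variables B M K : nat.

Hypothesis Delta_gt0 : (0 < Delta)%N.
Hypothesis lambda_ge0 : 0 <= lambda.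
Hypothesis mu_gt0 : forall m, 0 < mu m.
Hypothesis p01 : forall m, 0 <= p m <= 1.
Hypotheses (nuK : cancel nu idx) (idxK : cancel idx nu).
Hypothesis N0 : forall c, N c 0 = 0%N.
Hypothesis Nmono : forall c t u, 0 <= t -> t <= u -> (N c t <= N c u)%N.
Hypothesis Nrc : forall c t, 0 <= t -> N c x @[x --> t^'+] --> N c t.
Hypothesis U01 : forall j, (0 < j)%N -> 0 <= U j < 1.
Hypothesis n_gt0 : (0 < n)%N.
Hypothesis T_ge0 : 0 <= T.
Hypothesis traj : is_trajectory Delta lambda mu p nu idx N U n s l T s_init.
Hypothesis init_simplex : simplex s_init.
Hypothesis init_counts : forall v, exists k : nat, n%:R * s_init v = k%:R.
Hypothesis init_bounded : q nu s_init B.+1 = 0.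
Hypothesis K_large : forall v, (ntasks v <= M)%N -> (idx v < K)%N.

Local Notation arr := (arrivals lambda N n).
Local Notation tau := (jump_time lambda N n).
Local Notation A := (A_ Delta lambda nu idx N U n s l).
Local Notation Pt := (P_ mu p N n s).
Local Notation Dt := (D_ mu p N n s).
Local Notation leb := (@lebesgue_measure R).
Local Notation Th v t := (\int[leb]_(x in `[0, t]) s x v).

Hypothesis M_large : B%:R + n%:R^-1 * (arr T)%:R + Delta%:R <= M%:R :> R.

Definition routed (j : nat) (v : profile r) : R :=
  dispatch nu Delta (fun w => left_lim (s ^~ w) (tau j))
    (left_lim l (tau j)) (idx v) (U j).

Definition capped (x : R) : Prop := forall v, (M < ntasks v)%N -> s x v = 0.

Let n_pos : 0 < n%:R :> R. Proof. by rewrite ltr0n. Qed.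

Lemma s_ge0 t v : 0 <= t <= T -> 0 <= s t v.
Proof. by move=> /(trajectory_simplex traj)[/(_ v)/andP[]]. Qed.

Lemma s_rc v t : 0 <= t < T -> s x v @[x --> t^'+] --> s t v.
Proof. by move=> tT; have [+ _] := trajectory_cadlag_s traj v; apply. Qed.

Lemma s01 v t : 0 <= t <= T -> 0 <= s t v <= 1.
Proof. by move=> /(trajectory_simplex traj)[/(_ v)]. Qed.

Lemma P_integralE t v m : 0 <= t <= T -> Pt t v m =
  n%:R^-1 * (N (transition_clock v (src m))
    (n%:R * (p (src m) * mu (src m) * (v (src m))%:R * Th v t)))%:R.
Proof.
move=> /andP[t0 tT]; rewrite /P_ RintegralZl//.
have := @path_integrable R T (fun k x => s x (nu k))
  (fun k => @s_rc (nu k)) (fun k => @s01 (nu k)) (idx v) `[0, t].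
rewrite idxK; apply => x /=; rewrite !in_itv/= => /andP[-> xt].
exact: le_trans xt tT.
Qed.

Lemma D_integralE t v m : 0 <= t <= T -> Dt t v m =
  n%:R^-1 * (N (departure_clock v m)
    (n%:R * ((1 - p m) * mu m * (v m)%:R * Th v t)))%:R.
Proof.
move=> /andP[t0 tT]; rewrite /D_ RintegralZl//.
have := @path_integrable R T (fun k x => s x (nu k))
  (fun k => @s_rc (nu k)) (fun k => @s01 (nu k)) (idx v) `[0, t].
rewrite idxK; apply => x /=; rewrite !in_itv/= => /andP[-> xt].
exact: le_trans xt tT.
Qed.

Lemma occupation_vanish v t : 0 <= t <= T -> (forall x, 0 <= x < t -> s x v = 0) ->
  Th v t = 0.
Proof.
move=> tT sv; have := @integral_vanish R T (fun k x => s x (nu k))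
  (fun k => @s_rc (nu k)) (fun k => @s01 (nu k)) (idx v) t tT.
by rewrite idxK; apply.
Qed.

Lemma P_nonzero t v m : 0 <= t <= T -> (forall x, 0 <= x < t -> capped x) ->
  Pt t v m != 0 -> v (src m) != 0%N /\ (ntasks v <= M)%N.
Proof.
move=> tT sm; rewrite P_integralE// => H; split.
  by apply: contraNneq H => ->; rewrite mulr0 mul0r mulr0 N0 mulr0.
rewrite leqNgt; apply: contraNN H => h.
by rewrite occupation_vanish ?mulr0 ?N0 ?mulr0// => x /sm; apply.
Qed.

Lemma D_nonzero t v m : 0 <= t <= T -> (forall x, 0 <= x < t -> capped x) ->
  Dt t v m != 0 -> v m != 0%N /\ (ntasks v <= M)%N.
Proof.
move=> tT sm; rewrite D_integralE// => H; split.
  by apply: contraNneq H => ->; rewrite mulr0 mul0r mulr0 N0 mulr0.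
rewrite leqNgt; apply: contraNN H => h.
by rewrite occupation_vanish ?mulr0 ?N0 ?mulr0// => x /sm; apply.
Qed.

Lemma D_ge0 t v m : 0 <= Dt t v m. Proof. by rewrite /D_ mulr_ge0. Qed.

Lemma s_multiple t v : 0 <= t <= T -> n%:R * s t v \is a Num.int.
Proof.
move=> tT; rewrite (trajectory_s traj tT).
have IA w : n%:R * A t w \is a Num.int.
  rewrite /A_ mulVKf ?gt_eqF//; apply: rpred_sum => j _; exact: dispatch_int.
have IP w m : n%:R * Pt t w m \is a Num.int.
  by rewrite /P_ mulVKf ?gt_eqF// intr_nat.
have ID w m : n%:R * Dt t w m \is a Num.int.
  by rewrite /D_ mulVKf ?gt_eqF// intr_nat.
have I0 : n%:R * s_init v \is a Num.int.
  by have [k ->] := init_counts v; rewrite intr_nat.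
have I1 : n%:R * A_bar Delta lambda nu idx N U n s l t v \is a Num.int.
  by rewrite /A_bar mulrBr rpredB//; case: ifP => _; rewrite ?mulr0 ?rpred0.
have I2 : n%:R * P_bar mu p N n s t v \is a Num.int.
  rewrite /P_bar mulr_sumr rpred_sum// => m _; rewrite mulrBr rpredB//.
  by case: ifP => _; rewrite ?mulr0 ?rpred0.
have I3 : n%:R * D_bar mu p N n s t v \is a Num.int.
  by rewrite /D_bar mulr_sumr rpred_sum// => m _; rewrite mulrBr rpredB.
by rewrite 3!mulrDr; apply: rpredD I3; apply: rpredD I2; apply: rpredD I0 I1.
Qed.

(** The tail sum is defined with [fine]; its extended real value is bounded by 1, so
that it vanishes only if all its terms do. *)
Lemma init_support v : (B < ntasks v)%N -> s_init v = 0.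
Proof.
move=> Bv; have s0 w : (0 <= (s_init w)%:E)%E.
  by rewrite lee_fin; have /andP[] := init_simplex.1 w.
move: init_bounded; rewrite /q /tail_sum.
set X := (\sum_(0 <= k <oo | _) _)%E => X0.
have X1 : (X <= 1)%E.
  rewrite -(simplex_series nuK idxK init_simplex).
  rewrite /X eseries_mkcond lee_nneseries// => k; first by case: ifP.
  by case: ifP.
have Xge0 : (0 <= X)%E by apply: nneseries_ge0.
have Xf : X \is a fin_num by rewrite ge0_fin_numE// (le_lt_trans X1)// ltry.
have {}X0 : X = 0%E by rewrite -(fineK Xf) X0.
apply/eqP; rewrite eq_le -!lee_fin s0 andbT.
apply: (@le_trans _ _ X); last by rewrite X0.
have -> : (s_init v)%:E = (\sum_(idx v <= k < (idx v).+1 | (B < ntasks (nu k))%N) (s_init (nu k))%:E)%E.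
  by rewrite big_mkcond big_nat1 idxK Bv.
have := @nneseries_lim_ge R (fun k => (s_init (nu k))%:E)
   (fun k => (B < ntasks (nu k))%N) 0 (idx v).+1 (fun _ _ _ => s0 _).
apply: le_trans.
by rewrite (big_cat_nat (leq0n (idx v)) (leqnSn _))/= leeDr// sume_ge0.
Qed.

Lemma beyond_K k : (K <= k)%N -> (M < ntasks (nu k))%N.
Proof.
by move=> Kk; rewrite ltnNge; apply/negP => /K_large; rewrite nuK ltnNge Kk.
Qed.

Lemma capped_support x : capped x -> forall k, (K <= k)%N -> s x (nu k) = 0.
Proof. by move=> sx k /beyond_K; exact: sx. Qed.

Lemma capped_sum x : 0 <= x <= T -> capped x -> \sum_(0 <= k < K) s x (nu k) = 1.
Proof.
move=> xT sx; apply: (simplex_sum nuK idxK (capped_support sx)).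
exact: trajectory_simplex traj _ xT.
Qed.

Lemma u_bounds x : 0 <= x <= T -> (l x)%:R <= u nu (s x) < (l x + Delta)%:R.
Proof.
move=> xT; have := floor_mul_bounds (u nu (s x)) Delta_gt0.
by rewrite -(trajectory_l traj xT) natrD.
Qed.

(** Otherwise all pools would have l x + Delta tasks or more, and so would the mean,
which is less than l x + Delta by definition of the threshold. Hence the last
branch of the dispatching rule is never used. *)
Lemma q_below_1 x : 0 <= x <= T -> capped x -> q nu (s x) (l x + Delta) < 1.
Proof.
move=> xT sx; have /andP[_ ul] := u_bounds xT.
have sK := capped_support sx; have s1 := capped_sum xT sx.
have s0 v : 0 <= s x v by exact: s_ge0.
rewrite lt_neqAle (q_le1 sK s0 s1) andbT; apply/negP => /eqP q1.
move: ul; rewrite ltNge => /negP; apply.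
have -> : (l x + Delta)%:R = (l x + Delta)%:R * q nu (s x) (l x + Delta) :> R.
  by rewrite q1 mulr1.
rewrite (uE sK) (qE sK) mulr_sumr big_mkcond.
apply: ler_sum => k _; case: ifP => [h|_]; last by apply: mulr_ge0 => //; exact: s0.
by apply: ler_wpM2r; [exact: s0|rewrite ler_nat].
Qed.

(** The left limits are attained just before t because the state takes values in the
multiples of 1 / n on the finitely many profiles with at most M tasks. *)
Lemma left_state t : 0 < t <= T -> (forall x, 0 <= x < t -> capped x) ->
  \forall x \near t^'-, [/\ 0 <= x < t,
     (fun w => left_lim (s ^~ w) t) = s x & left_lim l t = l x].
Proof.
move=> /andP[t0 tT] sm.
have near_t : \forall x \near t^'-, 0 <= x < t.
  exists t => //= x /=; rewrite ltr_distlC => /andP[h _] xt.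
  by rewrite xt andbT; move: h; rewrite subrr => /ltW.
have near_l : \forall x \near t^'-, l x = left_lim l t.
  apply: nat_limit; have [_] := trajectory_cadlag_l traj; apply.
  by rewrite t0.
have near_s v : \forall x \near t^'-, s x v = left_lim (s ^~ v) t.
  apply: (@discrete_limit _ _ _ n) => //.
    by have [_] := trajectory_cadlag_s traj v; apply; rewrite t0.
  apply: filterS (near_t) => x /andP[x0 xt]; apply: s_multiple.
  by rewrite x0 (le_trans (ltW xt)).
have : \forall x \near t^'-, forall k : 'I_K, s x (nu k) = left_lim (s ^~ (nu k)) t.
  by apply: filter_forall => k; exact: near_s.
apply: filterS3 (near_t) near_l => x xt lx sx; split => //.
apply/funext => v; have [vK|Kv] := ltnP (idx v) K.
  by have := sx (Ordinal vK); rewrite /= idxK.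
have Mv : (M < ntasks v)%N by rewrite -(idxK v); exact: beyond_K.
rewrite (sm x xt v Mv); apply/cvg_lim => //.
by apply: cvg_near_cst; apply: filterS (near_t) => y yt; rewrite (sm y yt v Mv).
Qed.

(** The left limit at a jump is a state visited just before it, so that all that is
known about visited states applies to the routing. *)
Lemma routed_near j t : (0 < j)%N -> 0 <= t <= T -> (j <= arr t)%N ->
  (forall x, 0 <= x < tau j -> capped x) ->
  \forall x \near (tau j)^'-, 0 <= x < tau j /\
    forall v, routed j v = dispatch nu Delta (s x) (l x) (idx v) (U j).
Proof.
move=> j0 /andP[t0 tT] jt sm.
have taut : tau j <= T by apply: le_trans tT; exact: jump_time_le.
have tau0 : 0 < tau j by apply: (jump_time_gt0 lambda_ge0 N0 Nrc j0 t0 jt).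
have : \forall x \near (tau j)^'-, [/\ 0 <= x < tau j,
     (fun w => left_lim (s ^~ w) (tau j)) = s x & left_lim l (tau j) = l x].
  by apply: left_state => //; rewrite tau0.
apply: filterS => x [xt sx lx]; split => // v.
by rewrite /routed sx lx.
Qed.

Lemma routed_sum j t : (0 < j)%N -> 0 <= t <= T -> (j <= arr t)%N ->
  (forall x, 0 <= x < tau j -> capped x) ->
  \sum_(0 <= k < K) routed j (nu k) = 1.
Proof.
move=> j0 tT jt sm.
have [x [xt rx]] := @filter_ex _ _ _ _ (routed_near j0 tT jt sm).
have xT : 0 <= x <= T.
  move: xt tT => /andP[-> xt] /andP[t0 tT] /=.
  by rewrite (le_trans (ltW xt))// (le_trans _ tT)// jump_time_le.
under eq_bigr do rewrite rx nuK.
apply: dispatch_sum; [exact: capped_support (sm x xt)| | | |].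
- by move=> v; exact: s_ge0.
- exact: capped_sum (sm x xt).
- exact: U01.
- exact: q_below_1 (sm x xt).
Qed.

Lemma A_routedE t v : A t v = n%:R^-1 * \sum_(1 <= j < (arr t).+1) routed j v.
Proof. by []. Qed.

(** Each transition contributes the variation of phi along it. The hypotheses make
all the transition counts vanish outside of finitely many profiles, so that the
sums can be reindexed. *)
Lemma balance t (phi : profile r -> R) : 0 <= t <= T ->
  (forall x, 0 <= x <= t -> capped x) ->
  (forall v, (M <= ntasks v)%N -> A t v = 0) ->
  \sum_(0 <= k < K) phi (nu k) * s t (nu k) =
  \sum_(0 <= k < K) phi (nu k) * s_init (nu k) +
  \sum_(0 <= k < K) A t (nu k) * (phi (incr (nu k) ord0) - phi (nu k)) +
  \sum_(m < r) \sum_(0 <= k < K) Pt t (nu k) m * (phi (move (nu k) m) - phi (nu k)) +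
  \sum_(m < r.+1) \sum_(0 <= k < K)
     Dt t (nu k) m * (phi (decr (nu k) m) - phi (nu k)).
Proof.
move=> tT sm Avan.
have sm' x : 0 <= x < t -> capped x.
  by move=> /andP[x0 xt]; apply: sm; rewrite x0 ltW.
under eq_bigr do rewrite (trajectory_s traj tT) 3!mulrDr.
rewrite 3!big_split/=; congr (_ + _ + _ + _).
- transitivity (\sum_(0 <= k < K) phi (nu k) *
     (if nu k ord0 != 0%N then A t (decr (nu k) ord0) else 0) -
     \sum_(0 <= k < K) A t (nu k) * phi (nu k)).
    rewrite -sumrB; apply: eq_bigr => k _.
    by rewrite /A_bar mulrBr [phi _ * A t (nu k)]mulrC; case: ifP.
  rewrite (@transfer _ _ nu idx K nuK idxK phi (A t) (fun v => incr v ord0)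
    (fun v => decr v ord0) (fun v => v ord0 != 0%N)) -?sumrB.
  + by apply: eq_bigr => k _; rewrite mulrBr.
  + by move=> v; exact: decrK.
  + move=> w Aw; have wM : (ntasks w < M)%N.
      by rewrite ltnNge; apply: contraNN Aw => /Avan ->.
    by rewrite ffunE eqxx addn1 incrK; split => //; apply: K_large;
      rewrite ?ntasks_incr// ltnW.
- transitivity (\sum_(m < r) \sum_(0 <= k < K) phi (nu k) *
     ((if nu k (tgt m) != 0%N then Pt t (decr (incr (nu k) (src m)) (tgt m)) m else 0)
      - Pt t (nu k) m)).
    rewrite exchange_big/=; apply: eq_bigr => k _; rewrite /P_bar mulr_sumr.
    by apply: eq_bigr => m _; case: eqP.
  apply: eq_bigr => m _.
  rewrite [LHS](eq_bigr _ (fun k _ => mulrBr _ _ _)) sumrB.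
  have := @transfer _ _ nu idx K nuK idxK phi (fun v => Pt t v m) (fun v => move v m)
    (fun v => decr (incr v (src m)) (tgt m)) (fun v => v (tgt m) != 0%N).
  move=> /= ->; rewrite -?sumrB.
  + by apply: eq_bigr => k _; rewrite mulrBr [phi (nu k) * _]mulrC.
  + by move=> v; exact: unmoveK.
  + move=> w /(P_nonzero tT sm')[wm wM]; split.
    * by rewrite /move !ffunE eqxx [tgt m == _]eq_sym src_neq_tgt subn0 addn1.
    * exact: moveK.
    * exact: K_large.
    * by apply: K_large; rewrite ntasks_move.
- transitivity (\sum_(m < r.+1) \sum_(0 <= k < K) phi (nu k) *
     ((if xpredT (nu k) then Dt t (incr (nu k) m) m else 0) - Dt t (nu k) m)).
    rewrite exchange_big/=; apply: eq_bigr => k _; rewrite /D_bar mulr_sumr.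
    by apply: eq_bigr => m _.
  apply: eq_bigr => m _.
  rewrite [LHS](eq_bigr _ (fun k _ => mulrBr _ _ _)) sumrB.
  have := @transfer _ _ nu idx K nuK idxK phi (fun v => Dt t v m) (fun v => decr v m)
    (fun v => incr v m) xpredT.
  move=> /= ->; rewrite -?sumrB.
  + by apply: eq_bigr => k _; rewrite mulrBr [phi (nu k) * _]mulrC.
  + by move=> v _; exact: incrK.
  + move=> w /(D_nonzero tT sm')[wm wM]; split => //.
    * exact: decrK.
    * exact: K_large.
    * by apply: K_large; apply: leq_trans wM; rewrite -(ntasks_decr wm) leqnSn.
Qed.

Lemma A_sum t (c : R) : 0 <= t <= T -> (forall x, 0 <= x < t -> capped x) ->
  \sum_(0 <= k < K) A t (nu k) * c = n%:R^-1 * (arr t)%:R * c.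
Proof.
move=> tT sm; rewrite -mulr_suml; congr (_ * _).
under eq_bigr do rewrite A_routedE; rewrite -mulr_sumr; congr (_ * _).
rewrite exchange_big/= big_nat.
rewrite (eq_bigr (fun=> 1)) => [|j /andP[j0 jt]].
  by rewrite -big_nat big_const_nat iter_addr_0 subn1.
apply: (routed_sum j0 tT jt) => x /andP[x0 xt]; apply: sm; rewrite x0/=.
apply: lt_le_trans xt _; move: tT => /andP[t0 _]; exact: jump_time_le.
Qed.

(** In [balance] for the number of tasks, transitions between phases contribute
nothing, departures a negative amount and each arrival 1 / n. *)
Lemma mean_tasks_le t : 0 <= t <= T ->
  (forall x, 0 <= x <= t -> capped x) ->
  (forall v, (M <= ntasks v)%N -> A t v = 0) ->
  u nu (s t) <= B%:R + n%:R^-1 * (arr t)%:R.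
Proof.
move=> tT sm Avan.
have sm' x : 0 <= x < t -> capped x.
  by move=> /andP[x0 xt]; apply: sm; rewrite x0 ltW.
have t0 : 0 <= t by case/andP: tT.
have st : capped t by apply: sm; rewrite t0 lexx.
rewrite (uE (capped_support st)) (@balance t (fun v => (ntasks v)%:R))//.
have HP : \sum_(m < r) \sum_(0 <= k < K)
    Pt t (nu k) m * ((ntasks (move (nu k) m))%:R - (ntasks (nu k))%:R) = 0.
  apply: big1 => m _; apply: big1 => k _.
  have [->|/(P_nonzero tT sm')[h _]] := eqVneq (Pt t (nu k) m) 0.
    by rewrite mul0r.
  by rewrite ntasks_move// subrr mulr0.
have HD : \sum_(m < r.+1) \sum_(0 <= k < K)
    Dt t (nu k) m * ((ntasks (decr (nu k) m))%:R - (ntasks (nu k))%:R) <= 0.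
  apply: sumr_le0 => m _; apply: sumr_le0 => k _.
  have [->|/(D_nonzero tT sm')[h _]] := eqVneq (Dt t (nu k) m) 0.
    by rewrite mul0r.
  by rewrite mulr_ge0_le0 ?D_ge0// -(ntasks_decr h) subr_le0 ler_nat.
have HA : \sum_(0 <= k < K)
    A t (nu k) * ((ntasks (incr (nu k) ord0))%:R - (ntasks (nu k))%:R)
    = n%:R^-1 * (arr t)%:R.
  rewrite -[RHS]mulr1 -A_sum//; apply: eq_bigr => k _.
  by rewrite ntasks_incr -natr1 addrAC subrr add0r.
have HI : \sum_(0 <= k < K) (ntasks (nu k))%:R * s_init (nu k) <= B%:R.
  have HI1 : \sum_(0 <= k < K) s_init (nu k) = 1.
    apply: (simplex_sum nuK idxK _ init_simplex) => k /beyond_K Mk.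
    apply: init_support; apply: leq_trans Mk.
    rewrite ltnS -(ler_nat R); apply: le_trans M_large.
    by rewrite -addrA lerDl addr_ge0// mulr_ge0// ?invr_ge0.
  have -> : B%:R = B%:R * \sum_(0 <= k < K) s_init (nu k) :> R.
    by rewrite HI1 mulr1.
  rewrite mulr_sumr; apply: ler_sum => k _.
  have [kB|Bk] := leqP (ntasks (nu k)) B.
    by rewrite ler_wpM2r ?ler_nat//; have /andP[] := init_simplex.1 (nu k).
  by rewrite init_support// !mulr0.
rewrite HP HA addr0; lra.
Qed.

(** The equations alone allow mass to come from profiles with arbitrarily many
tasks, so that this is proved by induction on time. Before time t the mean number
of tasks is controlled, hence so is the threshold, and arrivals up to t go to
pools with fewer than M tasks. At time t itself the integrals on [0, t] see only
the past. After t the finitely many occupied profiles keep their mass for a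
while, and this mass is already 1. *)
Lemma capped_forever t : 0 <= t <= T ->
  capped t /\ (forall v, (M <= ntasks v)%N -> A t v = 0).
Proof.
move: t; apply: real_induction => [t tT IH|t tT IH].
  have sm x : 0 <= x < t -> capped x by move=> /IH[].
  move: (tT) => /andP[t0 tT'].
  have Avan v : (M <= ntasks v)%N -> A t v = 0.
    move=> Mv; rewrite A_routedE big_nat big1 ?mulr0// => j /andP[j0 jt].
    have taut : tau j <= t by exact: jump_time_le.
    have smj x : 0 <= x < tau j -> capped x.
      by move=> /andP[x0 xt]; apply: sm; rewrite x0 (lt_le_trans xt).
    have [x [xt ->]] := @filter_ex _ _ _ _ (routed_near j0 tT jt smj).
    move: (xt) => /andP[x0 xtau].
    have xtt : x < t by exact: lt_le_trans taut.
    have xT : 0 <= x <= T by rewrite x0 (le_trans (ltW xtt)).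
    have /IH[sx Ax] : 0 <= x < t by rewrite x0.
    apply: dispatch_full; first exact: q_below_1.
    rewrite idxK; apply: leq_trans Mv; rewrite -(ler_nat R).
    apply: le_trans M_large; rewrite natrD lerD2r.
    have /andP[lu _] := u_bounds xT; apply: (le_trans lu).
    apply: (le_trans (mean_tasks_le xT _ Ax)).
      by move=> y /andP[y0 yx]; apply: sm; rewrite y0 (le_lt_trans yx).
    rewrite lerD2l ler_wpM2l ?invr_ge0// ler_nat.
    by apply: arrivals_mono => //; case/andP: xT.
  split => // v Mv; rewrite (trajectory_s traj tT).
  have P0 w m : (M < ntasks w)%N -> Pt t w m = 0.
    move=> Mw; apply/eqP; apply: contraTT Mw => /(P_nonzero tT sm)[_].
    by rewrite -leqNgt.
  have D0 w m : (M < ntasks w)%N -> Dt t w m = 0.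
    move=> Mw; apply/eqP; apply: contraTT Mw => /(D_nonzero tT sm)[_].
    by rewrite -leqNgt.
  rewrite init_support; last first.
    apply: leq_ltn_trans Mv; rewrite -(ler_nat R); apply: le_trans M_large.
    by rewrite -addrA lerDl addr_ge0// mulr_ge0// ?invr_ge0.
  have -> : D_bar mu p N n s t v = 0.
    rewrite /D_bar big1// => m _.
    by rewrite !D0 ?subrr// ntasks_incr leqW.
  have -> : P_bar mu p N n s t v = 0.
    rewrite /P_bar big1// => m _; rewrite (P0 v)// subr0; case: ifPn => // vm.
    rewrite P0//; move: Mv; rewrite -{1}(unmoveK vm) ntasks_move//.
    by rewrite !ffunE eqxx src_neq_tgt subn0 addn1.
  rewrite /A_bar (Avan v (ltnW Mv)) subr0 add0r.
  rewrite !addr0; case: ifPn => // v0; apply: Avan.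
  by move: Mv; rewrite -(ntasks_decr v0) ltnS.
move: (tT) => /andP[t0 tT'].
have tTle : 0 <= t <= T by rewrite t0 ltW.
have sm x : 0 <= x <= t -> capped x by move=> /IH[].
have st : capped t by apply: sm; rewrite t0 lexx.
have near_t : \forall x \near t^'+, t < x < T.
  exists (T - t); rewrite /= ?subr_gt0// => x /= + tx.
  by rewrite distrC gtr0_norm ?subr_gt0// ltrBlDr subrK tx.
have near_s v : \forall x \near t^'+, s x v = s t v.
  apply: (@discrete_limit _ _ _ n) => //; first by apply: s_rc; rewrite t0.
  apply: filterS (near_t) => x /andP[tx xT]; apply: s_multiple.
  by rewrite (le_trans t0 (ltW tx)) ltW.
have all_s : \forall x \near t^'+, forall k : 'I_K, s x (nu k) = s t (nu k).
  by apply: filter_forall => k; exact: near_s.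
have near_arr := arrivals_rc n lambda_ge0 Nrc t0.
apply: filterS3 (near_t) all_s near_arr => x /andP[tx xT] sx ax.
have xT' : 0 <= x <= T by rewrite (le_trans t0 (ltW tx)) ltW.
split => [v Mv|v Mv].
  have [vK|Kv] := ltnP (idx v) K.
    by have := sx (Ordinal vK); rewrite /= idxK => ->; exact: st.
  rewrite -(idxK v); apply: (simplex_support nuK idxK (trajectory_simplex traj xT') _ Kv).
  rewrite -(capped_sum tTle st); rewrite !big_nat; apply: eq_bigr => k /andP[_ kK].
  exact: (sx (Ordinal kK)).
have /IH[_ At] : 0 <= t <= t by rewrite t0 lexx.
by rewrite A_routedE ax -A_routedE At.
Qed.

(** * Drift of linear functionals of the state *)

Lemma capped_at t : 0 <= t <= T -> capped t.
Proof. by move=> /capped_forever[]. Qed.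

Lemma sum_at t : 0 <= t <= T -> \sum_(0 <= k < K) s t (nu k) = 1.
Proof. by move=> tT; apply: capped_sum => //; exact: capped_at. Qed.

Definition mass (phi : profile r -> R) (t : R) : R :=
  \sum_(0 <= k < K) phi (nu k) * s t (nu k).

(** The generator of the service process of a pool, applied to phi. *)
Definition drift_rate (phi : profile r -> R) (v : profile r) : R :=
  \sum_(m < r) p (src m) * mu (src m) * (v (src m))%:R * (phi (move v m) - phi v) +
  \sum_(m < r.+1) (1 - p m) * mu m * (v m)%:R * (phi (decr v m) - phi v).

(** The sum of the variations of phi along all the transitions, which multiplies the
error made on each clock. *)
Definition oscillation (phi : profile r -> R) : R :=
  \sum_(m < r) \sum_(0 <= k < K) `|phi (move (nu k) m) - phi (nu k)| +
  \sum_(m < r.+1) \sum_(0 <= k < K) `|phi (decr (nu k) m) - phi (nu k)|.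

Lemma oscillation_ge0 phi : 0 <= oscillation phi.
Proof. by apply: addr_ge0; apply: sumr_ge0 => m _; apply: sumr_ge0. Qed.

(** A task that arrives in the time interval from t to u, t excluded, is dispatched
according to a state visited in this interval. *)
Lemma routed_from t u j : 0 <= t -> t <= u -> u <= T -> (arr t < j <= arr u)%N ->
  exists2 x, t < x <= u &
    forall v, routed j v = dispatch nu Delta (s x) (l x) (idx v) (U j).
Proof.
move=> t0 tu uT /andP[tj ju].
have j0 : (0 < j)%N by apply: leq_ltn_trans tj.
have u0 : 0 <= u by exact: le_trans tu.
have t_tau : t < tau j by exact: (jump_time_gt lambda_ge0 Nmono Nrc u0 ju t0 tj).
have tau_u : tau j <= u by exact: jump_time_le.
have sm x : 0 <= x < tau j -> capped x.
  move=> /andP[x0 xt]; apply: capped_at; rewrite x0/=.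
  by rewrite (le_trans (ltW xt))// (le_trans tau_u).
have uT' : 0 <= u <= T by rewrite u0.
have near_t : \forall x \near (tau j)^'-, t < x by exact: nbhs_left_gt.
have [x [tx [/andP[x0 xt] rx]]] :=
  @filter_ex _ _ _ _ (filterI near_t (routed_near j0 uT' ju sm)).
by exists x => //; rewrite tx (le_trans (ltW xt)).
Qed.

Lemma routed_sum_at t j : 0 <= t <= T -> (0 < j <= arr t)%N ->
  \sum_(0 <= k < K) routed j (nu k) = 1.
Proof.
move=> tT /andP[j0 jt]; have [t0 tT'] := andP tT.
apply: (routed_sum j0 tT jt) => x /andP[x0 xt]; apply: capped_at; rewrite x0/=.
by rewrite (le_trans (ltW xt))// (le_trans _ tT')// jump_time_le.
Qed.

Lemma arrival_increment t u (g : nat -> R) (a : R) :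
  0 <= t -> t <= u -> u <= T ->
  (forall j, (arr t < j <= arr u)%N -> \sum_(0 <= k < K) routed j (nu k) * g k <= a) ->
  \sum_(0 <= k < K) A u (nu k) * g k - \sum_(0 <= k < K) A t (nu k) * g k <=
  a * (n%:R^-1 * (arr u)%:R - n%:R^-1 * (arr t)%:R).
Proof.
move=> t0 tu uT Ha.
have atu : (arr t <= arr u)%N by exact: arrivals_mono.
have -> : \sum_(0 <= k < K) A u (nu k) * g k - \sum_(0 <= k < K) A t (nu k) * g k =
   n%:R^-1 * \sum_((arr t).+1 <= j < (arr u).+1) \sum_(0 <= k < K) routed j (nu k) * g k.
  rewrite -sumrB exchange_big/= mulr_sumr; apply: eq_bigr => k _.
  rewrite !A_routedE (@big_cat_nat _ _ _ (arr t).+1 1 (arr u).+1)//=.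
  by rewrite -mulrBl -mulrBr addrAC subrr add0r -mulr_suml mulrA.
rewrite -mulrBr mulrCA ler_wpM2l ?invr_ge0//.
apply: (@le_trans _ _ (\sum_((arr t).+1 <= j < (arr u).+1) a)).
  by apply: ler_sum_nat => j /andP[h1 h2]; apply: Ha; rewrite h1.
by rewrite big_const_nat iter_addr_0 subSS -natrB// mulr_natr.
Qed.

Variable eps : R.
Hypothesis err_A : forall t, 0 <= t <= T ->
  `|n%:R^-1 * (arr t)%:R - lambda * t| <= eps.
Hypothesis err_P : forall t k m, 0 <= t <= T -> (k < K)%N ->
  `|Pt t (nu k) m -
    p (src m) * mu (src m) * (nu k (src m))%:R * Th (nu k) t| <= eps.
Hypothesis err_D : forall t k m, 0 <= t <= T -> (k < K)%N ->
  `|Dt t (nu k) m - (1 - p m) * mu m * (nu k m)%:R * Th (nu k) t| <= eps.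

Let eps_ge0 : 0 <= eps.
Proof. by apply: le_trans (err_A (t := 0) _); rewrite ?lexx. Qed.

Lemma increment_error (x y X Y g : R) : `|x - X| <= eps -> `|y - Y| <= eps ->
  y * g - x * g <= (Y - X) * g + 2 * eps * `|g|.
Proof.
move=> hx hy; rewrite -mulrBl -lerBlDl -mulrBl.
apply: (le_trans (ler_norm _)); rewrite normrM ler_wpM2r//.
have -> : y - x - (Y - X) = (y - Y) - (x - X) by ring.
apply: (le_trans (ler_normB _ _)); lra.
Qed.

Lemma mass_increment_le (phi : profile r -> R) (a kap t u : R) :
  0 <= t -> t <= u -> u <= T ->
  (forall j, (arr t < j <= arr u)%N ->
     \sum_(0 <= k < K) routed j (nu k) * (phi (incr (nu k) ord0) - phi (nu k)) <= a) ->
  (forall x, t < x <= u -> a * lambda + mass (drift_rate phi) x <= kap) ->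
  mass phi u - mass phi t <= kap * (u - t) + eps * (2 * `|a| + 2 * oscillation phi).
Proof.
move=> t0 tu uT Ha Hkap.
have tT : 0 <= t <= T by rewrite t0 (le_trans tu).
have uT' : 0 <= u <= T by rewrite (le_trans t0 tu).
have smT x : 0 <= x <= T -> forall y, 0 <= y <= x -> capped y.
  move=> /andP[_ xT] y /andP[y0 yx]; apply: capped_at.
  by rewrite y0 (le_trans yx).
rewrite /mass (balance _ uT' (smT u uT') (capped_forever uT').2).
rewrite (balance _ tT (smT t tT) (capped_forever tT).2).
set I := \sum_(0 <= k < K) phi (nu k) * s_init (nu k).
set Au := \sum_(0 <= k < K) A u _ * _; set At := \sum_(0 <= k < K) A t _ * _.
set Pu := \sum_(m < r) \sum_(0 <= k < K) Pt u _ _ * _.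
set Ptt := \sum_(m < r) \sum_(0 <= k < K) Pt t _ _ * _.
set Du := \sum_(m < r.+1) \sum_(0 <= k < K) Dt u _ _ * _.
set Dtt := \sum_(m < r.+1) \sum_(0 <= k < K) Dt t _ _ * _.
have HA : Au - At <= a * (lambda * (u - t)) + eps * (2 * `|a|).
  apply: (le_trans (arrival_increment t0 tu uT Ha)).
  have := increment_error a (err_A tT) (err_A uT').
  by rewrite -mulrBl -mulrBr ![_ * a]mulrC; lra.
have HP : Pu - Ptt <=
    \sum_(0 <= k < K) (\sum_(m < r) p (src m) * mu (src m) * (nu k (src m))%:R *
        (phi (move (nu k) m) - phi (nu k))) * (Th (nu k) u - Th (nu k) t) +
    2 * eps * \sum_(m < r) \sum_(0 <= k < K) `|phi (move (nu k) m) - phi (nu k)|.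
  have -> : \sum_(0 <= k < K) (\sum_(m < r) p (src m) * mu (src m) * (nu k (src m))%:R *
        (phi (move (nu k) m) - phi (nu k))) * (Th (nu k) u - Th (nu k) t) =
      \sum_(m < r) \sum_(0 <= k < K) p (src m) * mu (src m) * (nu k (src m))%:R *
        (phi (move (nu k) m) - phi (nu k)) * (Th (nu k) u - Th (nu k) t).
    by rewrite exchange_big/=; apply: eq_bigr => k _; rewrite mulr_suml.
  rewrite /Pu /Ptt -sumrB mulr_sumr -big_split/=; apply: ler_sum => m _.
  rewrite -sumrB mulr_sumr -big_split/=; apply: ler_sum_nat => k /andP[_ kK].
  have := increment_error (phi (move (nu k) m) - phi (nu k))
    (err_P m tT kK) (err_P m uT' kK).
  by move=> /le_trans; apply; rewrite le_eqVlt; apply/orP; left; apply/eqP; ring.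
have HD : Du - Dtt <=
    \sum_(0 <= k < K) (\sum_(m < r.+1) (1 - p m) * mu m * (nu k m)%:R *
        (phi (decr (nu k) m) - phi (nu k))) * (Th (nu k) u - Th (nu k) t) +
    2 * eps * \sum_(m < r.+1) \sum_(0 <= k < K) `|phi (decr (nu k) m) - phi (nu k)|.
  have -> : \sum_(0 <= k < K) (\sum_(m < r.+1) (1 - p m) * mu m * (nu k m)%:R *
        (phi (decr (nu k) m) - phi (nu k))) * (Th (nu k) u - Th (nu k) t) =
      \sum_(m < r.+1) \sum_(0 <= k < K) (1 - p m) * mu m * (nu k m)%:R *
        (phi (decr (nu k) m) - phi (nu k)) * (Th (nu k) u - Th (nu k) t).
    by rewrite exchange_big/=; apply: eq_bigr => k _; rewrite mulr_suml.
  rewrite /Du /Dtt -sumrB mulr_sumr -big_split/=; apply: ler_sum => m _.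
  rewrite -sumrB mulr_sumr -big_split/=; apply: ler_sum_nat => k /andP[_ kK].
  have := increment_error (phi (decr (nu k) m) - phi (nu k))
    (err_D m tT kK) (err_D m uT' kK).
  by move=> /le_trans; apply; rewrite le_eqVlt; apply/orP; left; apply/eqP; ring.
have HG : \sum_(0 <= k < K) drift_rate phi (nu k) * (Th (nu k) u - Th (nu k) t) <=
    (kap - a * lambda) * (u - t).
  apply: (@integral_increment_le R T (fun k x => s x (nu k))
    (fun k => @s_rc (nu k)) (fun k => @s01 (nu k)) K (fun k => drift_rate phi (nu k))) => //.
  by move=> x /Hkap; rewrite /mass; lra.
move: HG; under eq_bigr do rewrite /drift_rate mulrDl; rewrite big_split/=.
rewrite /oscillation; lra.
Qed.

Lemma mass_increment_ge (phi : profile r -> R) (a kap t u : R) :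
  0 <= t -> t <= u -> u <= T ->
  (forall j, (arr t < j <= arr u)%N ->
     a <= \sum_(0 <= k < K) routed j (nu k) * (phi (incr (nu k) ord0) - phi (nu k))) ->
  (forall x, t < x <= u -> kap <= a * lambda + mass (drift_rate phi) x) ->
  kap * (u - t) - eps * (2 * `|a| + 2 * oscillation phi) <= mass phi u - mass phi t.
Proof.
move=> t0 tu uT Ha Hkap.
(* The lower bound is the upper bound for the opposite functional. *)
pose psi v := - phi v.
have E v w : psi v - psi w = - (phi v - phi w) by rewrite /psi opprB opprK addrC.
have massN f g x : (forall v, f v = - g v) -> mass f x = - mass g x.
  by move=> fg; rewrite /mass -sumrN; apply: eq_bigr => k _; rewrite fg mulNr.
have oscN : oscillation psi = oscillation phi.
  by rewrite /oscillation; congr (_ + _); apply: eq_bigr => m _;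
    apply: eq_bigr => k _; rewrite E normrN.
have driftN v : drift_rate psi v = - drift_rate phi v.
  rewrite /drift_rate opprD -!sumrN.
  by congr (_ + _); apply: eq_bigr => m _; rewrite E mulrN.
have := @mass_increment_le psi (- a) (- kap) t u t0 tu uT.
rewrite !(massN psi phi)// oscN normrN => h.
suff : - mass phi u - - mass phi t <=
    - kap * (u - t) + eps * (2 * `|a| + 2 * oscillation phi) by lra.
apply: h => [j /Ha h|x /Hkap].
  under eq_bigr do rewrite E mulrN.
  by rewrite sumrN lerN2.
by rewrite (massN _ _ x driftN); lra.
Qed.

(** * Mean numbers of tasks *)

Lemma mass_le (phi psi : profile r -> R) x : 0 <= x <= T ->
  (forall v, (ntasks v <= M)%N -> phi v <= psi v) -> mass phi x <= mass psi x.
Proof.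
move=> xT h; apply: ler_sum => k _.
have [kM|Mk] := leqP (ntasks (nu k)) M.
  by apply: ler_wpM2r; [exact: s_ge0|exact: h].
by rewrite (capped_at xT Mk) !mulr0.
Qed.

Lemma mass_cst (c : R) x : 0 <= x <= T -> mass (fun=> c) x = c.
Proof. by move=> xT; rewrite /mass -mulr_sumr sum_at// mulr1. Qed.

Lemma mass_ge0 (phi : profile r -> R) x : 0 <= x <= T ->
  (forall v, 0 <= phi v) -> 0 <= mass phi x.
Proof. by move=> xT h; rewrite -(mass_cst 0 xT); apply: mass_le. Qed.

Lemma mass_lin (a b : R) (phi psi : profile r -> R) x :
  mass (fun v => a * phi v + b * psi v) x = a * mass phi x + b * mass psi x.
Proof.
rewrite /mass !mulr_sumr -big_split/=; apply: eq_bigr => k _; ring.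
Qed.

Lemma mass_sum (I : finType) (c : I -> R) (phi : I -> profile r -> R) x :
  mass (fun v => \sum_i c i * phi i v) x = \sum_i c i * mass (phi i) x.
Proof.
rewrite /mass; under [RHS]eq_bigr do rewrite mulr_sumr.
rewrite [RHS]exchange_big/=; apply: eq_bigr => k _.
by rewrite mulr_suml; apply: eq_bigr => i _; rewrite mulrA.
Qed.

Lemma eq_mass (phi psi : profile r -> R) x : phi =1 psi -> mass phi x = mass psi x.
Proof. by move=> h; apply: eq_bigr => k _; rewrite h. Qed.

Definition in_phase (m : 'I_r.+1) (v : profile r) : R := (v m)%:R.

Definition tasks (v : profile r) : R := (ntasks v)%:R.

Lemma tasksE v : tasks v = \sum_m 1 * in_phase m v.
Proof.
rewrite /tasks /ntasks natr_sum; apply: eq_bigr => m _.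
by rewrite mul1r.
Qed.

Lemma mass_tasks t : 0 <= t <= T -> u nu (s t) = mass tasks t.
Proof. by move=> tT; rewrite (uE (capped_support (capped_at tT))). Qed.

Lemma mass_tasks_sum t : mass tasks t = \sum_m mass (in_phase m) t.
Proof.
rewrite (eq_mass _ tasksE) mass_sum; apply: eq_bigr => m _.
by rewrite mul1r.
Qed.

Lemma mean_tasks_growth t : 0 <= t <= T -> mass tasks t <= B%:R + lambda * t + eps.
Proof.
move=> tT; rewrite -mass_tasks//.
have h : u nu (s t) <= B%:R + n%:R^-1 * (arr t)%:R.
  apply: mean_tasks_le (tT) _ (capped_forever tT).2 => y /andP[y0 yt].
  by apply: capped_at; rewrite y0 (le_trans yt)//; case/andP: tT.
have := err_A tT; rewrite ler_norml => /andP[_]; lra.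
Qed.

Lemma in_phase_move (m : 'I_r.+1) (i : 'I_r) (v : profile r) : v (src i) != 0%N ->
  in_phase m (move v i) - in_phase m v = (m == tgt i)%:R - (m == src i)%:R.
Proof.
move=> vi; rewrite /in_phase !ffunE.
have [->|mi] := eqVneq m (src i).
  by rewrite src_neq_tgt addn0 natrB ?lt0n//=; ring.
by rewrite subn0 natrD /=; ring.
Qed.

Hypothesis p_last : p ord_max = 0.

(** Since p vanishes at the last phase, departures and transitions out of phase m
add up to the rate mu m also there. *)
Lemma drift_in_phase m v : drift_rate (in_phase m) v =
  \sum_(i < r) p (src i) * mu (src i) * in_phase (src i) v * (m == tgt i)%:R -
  mu m * in_phase m v.
Proof.
rewrite /drift_rate.
have -> : \sum_(i < r.+1) (1 - p i) * mu i * (v i)%:R *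
    (in_phase m (decr v i) - in_phase m v) = - ((1 - p m) * mu m * in_phase m v).
  rewrite (bigD1 m)//= [X in _ + X]big1 ?addr0 => [|i im].
    rewrite /in_phase ffunE eqxx; case: (posnP (v m)) => [->|v0].
      by rewrite mulr0 mul0r oppr0.
    by rewrite natrB//=; ring.
  by rewrite /in_phase ffunE eq_sym (negbTE im) subn0 subrr mulr0.
have -> : \sum_(i < r) p (src i) * mu (src i) * (v (src i))%:R *
    (in_phase m (move v i) - in_phase m v) =
  \sum_(i < r) p (src i) * mu (src i) * in_phase (src i) v * (m == tgt i)%:R -
  \sum_(i < r) p (src i) * mu (src i) * in_phase (src i) v * (m == src i)%:R.
  rewrite -sumrB; apply: eq_bigr => i _; rewrite -mulrBr.
  have [vi|vi] := eqVneq (v (src i)) 0%N.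
    by rewrite /in_phase vi !mulr0 !mul0r.
  by rewrite in_phase_move.
have -> : \sum_(i < r) p (src i) * mu (src i) * in_phase (src i) v * (m == src i)%:R
    = p m * mu m * in_phase m v.
  have [mr|rm] := ltnP m r.
    have -> : m = src (Ordinal mr) by apply: val_inj.
    rewrite (bigD1 (Ordinal mr))//= eqxx mulr1 big1 ?addr0// => i im.
    rewrite (_ : (_ == _) = false) ?mulr0//; apply/negbTE.
    by apply: contraNneq im => /(congr1 val)/= e; apply/eqP/val_inj.
  have -> : m = ord_max by apply: val_inj => /=; have := ltn_ord m; lia.
  rewrite p_last !mul0r big1// => i _.
  rewrite (_ : (_ == _) = false) ?mulr0//; apply/negbTE.
  by rewrite -val_eqE/=; have := ltn_ord i; lia.
ring.
Qed.

Lemma phases_system (e : R) : eps <= 1 ->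
  (forall m, eps * (2 + 2 * oscillation (in_phase m)) <= e) ->
  approx_system lambda B%:R mu p (fun m t => mass (in_phase m) t) T M%:R e.
Proof.
move=> eps1 He.
have in_phase_le m v : in_phase m v <= tasks v.
  by rewrite /in_phase /tasks ler_nat /ntasks (bigD1 m)//= leq_addr.
have arr_m m t u' : 0 <= t -> t <= u' -> u' <= T -> forall j, (arr t < j <= arr u')%N ->
    \sum_(0 <= k < K) routed j (nu k) *
      (in_phase m (incr (nu k) ord0) - in_phase m (nu k)) = (m == ord0)%:R.
  move=> t0 tu uT j /andP[tj ju].
  under eq_bigr do rewrite /in_phase ffunE natrD addrAC subrr add0r.
  rewrite -mulr_suml (@routed_sum_at u') ?mul1r ?(le_trans t0)//.
  by rewrite (leq_ltn_trans _ tj).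
have E m x : (m == ord0)%:R * lambda + mass (drift_rate (in_phase m)) x =
    inflow lambda mu p (fun m => mass (in_phase m) x) m - mu m * mass (in_phase m) x.
  rewrite /inflow -addrA; congr (_ + _).
  pose c (i : 'I_r) := p (src i) * mu (src i) * (m == tgt i)%:R.
  have Ed v : drift_rate (in_phase m) v = 1 * (\sum_(i < r) c i * in_phase (src i) v) +
      (- mu m) * in_phase m v.
    rewrite drift_in_phase mul1r mulNr; congr (_ - _).
    by apply: eq_bigr => i _; rewrite /c; ring.
  rewrite (eq_mass _ Ed) mass_lin mul1r mulNr mass_sum; congr (_ - _).
  by apply: eq_bigr => i _; rewrite /c; ring.
have eq_le_imp (a b : R) : a = b -> a <= b by move=> ->.
have abs_m (m : 'I_r.+1) : `|(m == ord0)%:R| <= 1 :> R.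
  by case: (m == ord0); rewrite ?normr1 ?normr0.
have err_m (m : 'I_r.+1) :
    eps * (2 * `|(m == ord0)%:R| + 2 * oscillation (in_phase m)) <= e.
  apply: le_trans (He m); apply: ler_wpM2l => //; rewrite lerD2r.
  by have := abs_m m; lra.
split.
- move=> m t tT; rewrite mass_ge0//=.
  rewrite -(mass_cst M%:R tT); apply: mass_le => // v vM.
  by apply: (le_trans (in_phase_le m v)); rewrite /tasks ler_nat.
- move=> m t tT; have := mean_tasks_growth tT.
  have : mass (in_phase m) t <= mass tasks t by apply: mass_le.
  lra.
- move=> m t u' kap t0 tu uT Hk.
  have := @mass_increment_le (in_phase m) (m == ord0)%:R kap t u' t0 tu uT.
  move=> h; have {}h := h (fun j jj => eq_le_imp _ _ (arr_m m t u' t0 tu uT j jj)).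
  have := err_m m.
  have : mass (in_phase m) u' - mass (in_phase m) t <= kap * (u' - t) +
      eps * (2 * `|(m == ord0)%:R| + 2 * oscillation (in_phase m)).
    by apply: h => x /Hk; rewrite E.
  lra.
- move=> m t u' kap t0 tu uT Hk.
  have := @mass_increment_ge (in_phase m) (m == ord0)%:R kap t u' t0 tu uT.
  move=> h; have {}h := h (fun j jj => eq_le_imp _ _ (esym (arr_m m t u' t0 tu uT j jj))).
  have := err_m m.
  have : kap * (u' - t) -
      eps * (2 * `|(m == ord0)%:R| + 2 * oscillation (in_phase m)) <=
      mass (in_phase m) u' - mass (in_phase m) t.
    by apply: h => x /Hk; rewrite E.
  lra.
Qed.

Definition service (v : profile r) : R := \sum_m (1 - p m) * mu m * in_phase m v.

(** Only departures change the number of tasks of a pool. *)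
Lemma drift_of_level (g : nat -> R) v : drift_rate (fun w => g (ntasks w)) v =
  service v * (g (ntasks v).-1 - g (ntasks v)).
Proof.
rewrite /drift_rate big1 ?add0r => [|i _].
  rewrite /service mulr_suml; apply: eq_bigr => m _.
  have [vm|vm] := eqVneq (v m) 0%N; first by rewrite /in_phase vm !mulr0 !mul0r.
  by rewrite -(ntasks_decr vm).
have [vm|vm] := eqVneq (v (src i)) 0%N; first by rewrite vm !mulr0 !mul0r.
by rewrite ntasks_move// subrr mulr0.
Qed.

(** * The regime where the phases are close to equilibrium *)

Lemma routed_ge0 j v : 0 <= routed j v.
Proof.
rewrite /routed /dispatch !indicE; case: ifP => _ //; by case: ifP => _; rewrite mulr_ge0.
Qed.

Section plateau.
Variables (sigma1 alpha delta kap : R) (f : nat).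
Let L := (f * Delta)%N.
Let rho := \sum_m equil lambda mu p m.
Let slack := r.+1%:R * alpha.
Hypothesis sigma1_ge0 : 0 <= sigma1.
Hypothesis near_equil : forall m t, sigma1 <= t <= T ->
  `|mass (in_phase m) t - equil lambda mu p m| <= alpha.
Hypothesis gap_low : L%:R <= rho - slack.
Hypothesis gap_high : rho + slack < (L + Delta)%:R.
Hypothesis delta_gt0 : 0 < delta.
Hypothesis delta_le : forall m, delta <= (1 - p m) * mu m.
Hypothesis kap_gt0 : 0 < kap.
Hypothesis kap_le : alpha * \sum_m mu m + kap <= delta * (rho - slack - L%:R).

Let in_T t : sigma1 <= t <= T -> 0 <= t <= T.
Proof. by move=> /andP[h ->]; rewrite (le_trans sigma1_ge0 h). Qed.

Lemma tasks_near t : sigma1 <= t <= T -> `|mass tasks t - rho| <= slack.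
Proof.
move=> tT; rewrite mass_tasks_sum /rho -sumrB.
apply: (le_trans (ler_norm_sum _ _ _)).
apply: (@le_trans _ _ (\sum_(m < r.+1) alpha)).
  by apply: ler_sum => m _; exact: near_equil.
by rewrite sumr_const card_ord -mulr_natl.
Qed.

Lemma threshold_eq t : sigma1 <= t <= T -> l t = L.
Proof.
move=> tT; have /andP[l1 l2] := u_bounds (in_T tT).
have := tasks_near tT; rewrite -mass_tasks ?in_T// ler_norml => /andP[h1 h2].
have gl := gap_low; have gh := gap_high.
have hl : L%:R < (l t + Delta)%:R :> R by apply: le_lt_trans l2; lra.
have hr : (l t)%:R < (L + Delta)%:R :> R by apply: le_lt_trans l1 _; lra.
rewrite !ltr_nat in hl hr.
have [z lz] : exists z : int, (l t)%:Z = z * Delta%:Z.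
  by exists (Num.floor (u nu (s t) / Delta%:R)); rewrite (trajectory_l traj (in_T tT)).
have z0 : 0 <= z.
  by rewrite -(@pmulr_lge0 _ Delta%:Z) -?lz.
move: z0 lz; case: z => // z _; rewrite -PoszM => -[lz].
rewrite lz /L in hl hr *.
have fz : (f < z.+1)%N by rewrite -(ltn_pmul2r Delta_gt0) mulSnr.
have zf : (z < f.+1)%N by rewrite -(ltn_pmul2r Delta_gt0) mulSnr.
by congr (_ * _)%N; apply/eqP; rewrite eqn_leq -ltnS zf -ltnS fz.
Qed.

Lemma service_ge v : delta * tasks v <= service v.
Proof.
rewrite tasksE mulr_sumr /service; apply: ler_sum => m _.
by rewrite mul1r ler_wpM2r.
Qed.

Lemma service_le v : service v <= (\sum_m mu m) * tasks v.
Proof.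
rewrite /service mulr_suml; apply: ler_sum => m _.
have [p0 p1] := andP (p01 m); have m0 := mu_gt0 m.
apply: ler_pM; rewrite ?mulr_ge0 ?subr_ge0 ?(ltW m0)//.
  by rewrite ler_piMl ?(ltW m0)// gerBl.
by rewrite /in_phase /tasks ler_nat /ntasks (bigD1 m)//= leq_addr.
Qed.

Lemma service_ge0 v : 0 <= service v.
Proof. by apply: le_trans (service_ge v); rewrite mulr_ge0// ltW. Qed.

(** At equilibrium the departure rate is lambda. *)
Lemma mass_service t : sigma1 <= t <= T ->
  mass service t <= lambda + alpha * \sum_m mu m.
Proof.
move=> tT; rewrite /service mass_sum.
rewrite -[X in X + _](equil_departures lambda mu_gt0 p_last).
rewrite mulr_sumr -big_split/=; apply: ler_sum => m _.
have := near_equil m tT; rewrite ler_norml => /andP[_ h].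
have [p0 p1] := andP (p01 m); have m0 := mu_gt0 m.
have c0 : 0 <= (1 - p m) * mu m by rewrite mulr_ge0 ?subr_ge0// ltW.
have a0 : 0 <= alpha by apply: le_trans (near_equil m tT).
apply: (@le_trans _ _ ((1 - p m) * mu m * (equil lambda mu p m + alpha))).
  by rewrite ler_wpM2l//; lra.
rewrite mulrDr lerD2l mulrC ler_wpM2l// ler_piMl ?(ltW m0)// gerBl//.
Qed.

Definition shortfall (v : profile r) : R := (L - ntasks v)%N%:R.

(** The shortfall is at most L times the fraction of pools with fewer than L tasks;
it is positive only if this fraction is. *)
Lemma shortfall_q t : 0 <= t <= T -> mass shortfall t <= L%:R * (1 - q nu (s t) L).
Proof.
move=> tT; rewrite (q_compl (capped_support (capped_at tT)) (sum_at tT)).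
rewrite mulr_sumr [leRHS]big_mkcond; apply: ler_sum => k _.
have st0 : 0 <= s t (nu k) by exact: s_ge0.
rewrite /shortfall; case: ltnP => h.
  by rewrite ler_wpM2r// ler_nat leq_subr.
by rewrite (eqP (h : (_ - _ == 0)%N)) mul0r.
Qed.

Lemma q_shortfall t i : 0 <= t <= T -> (i <= L)%N ->
  `|1 - q nu (s t) i| <= mass shortfall t.
Proof.
move=> tT iL; rewrite (q_compl (capped_support (capped_at tT)) (sum_at tT)).
have st0 k : 0 <= s t (nu k) by exact: s_ge0.
rewrite ger0_norm ?sumr_ge0// big_mkcond; apply: ler_sum => k _.
case: ltnP => h; last by rewrite mulr_ge0.
rewrite -[leLHS]mul1r ler_wpM2r// (_ : 1 = 1%:R)// ler_nat subn_gt0.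
exact: leq_trans h iL.
Qed.

Let e_fill := eps * (2 * 1 + 2 * oscillation shortfall).

(** While the shortfall is positive some pool has fewer than L tasks, and arrivals
reduce the shortfall at rate lambda. Departures increase it at a rate at most
mass service - delta * (mass tasks - L), since the departures from a pool v with
more than L tasks, whose rate is at least delta * (tasks v - L), do not change
the shortfall. *)
Lemma filling t : sigma1 + L%:R / kap <= t <= T -> mass shortfall t <= 2 * e_fill.
Proof.
move=> /andP[t1 tT]; rewrite -[leRHS]add0r.
have s1t : sigma1 <= t by apply: le_trans t1; rewrite lerDl divr_ge0// ltW.
have s1T : sigma1 <= sigma1 <= T by rewrite lexx (le_trans s1t).
pose C : R := (\sum_m mu m) * M%:R.
have C0 : 0 <= C by rewrite mulr_ge0// sumr_ge0// => m _; exact: ltW.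
have osc0 := oscillation_ge0 shortfall.
have dec v : shortfall (incr v ord0) <= shortfall v.
  by rewrite /shortfall ler_nat leq_sub2l// ntasks_incr leqnSn.
have drift_le v : drift_rate shortfall v <= service v *
    (if (ntasks v <= L)%N then 1 else 0).
  rewrite (drift_of_level (fun i => (L - i)%N%:R)) ler_wpM2l ?service_ge0//.
  case: ifP => h; last first.
    by rewrite subn_pred_eq0 ?h// sub0r oppr_le0.
  by rewrite lerBlDl -[X in _ + X]/(1%:R) -natrD ler_nat subn_pred_le.
apply: (@settle R (mass shortfall) sigma1 T 0 L%:R kap C e_fill) => //.
- rewrite add0r -(mass_cst L%:R (in_T s1T)); apply: mass_le => [|v _]; first exact: in_T.
  by rewrite /shortfall ler_nat leq_subr.
- move=> x y s1x xy yT.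
  have x0 := le_trans sigma1_ge0 s1x.
  have h := @mass_increment_le shortfall 0 C x y x0 xy yT.
  apply: (le_trans (h _ _)).
  + move=> j _; apply: sumr_le0 => k _; rewrite mulr_ge0_le0 ?routed_ge0// subr_le0.
    exact: dec.
  + move=> z /andP[xz zy]; rewrite mul0r add0r.
    have zT : 0 <= z <= T by rewrite (le_trans x0 (ltW xz)) (le_trans zy).
    rewrite -(mass_cst C zT); apply: mass_le => // v vM.
    apply: (le_trans (drift_le v)); apply: (@le_trans _ _ (service v)).
      by rewrite ler_piMr ?service_ge0//; case: ifP.
    apply: (le_trans (service_le v)); rewrite ler_wpM2l ?sumr_ge0// => [m _|].
      exact: ltW.
    by rewrite /tasks ler_nat.
  + rewrite lerD2l normr0 mulr0 add0r ler_wpM2l// lerDr; lra.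
- move=> x y s1x xy yT above.
  have x0 := le_trans sigma1_ge0 s1x.
  have low z : x < z <= y -> q nu (s z) (l z) < 1.
    move=> /[dup] /above pos /andP[xz zy].
    have zT : sigma1 <= z <= T by rewrite (le_trans s1x (ltW xz)) (le_trans zy).
    rewrite (threshold_eq zT) lt_neqAle (q_le1 (capped_support (capped_at (in_T zT)))
      _ (sum_at (in_T zT))) ?andbT; last by move=> v; exact: s_ge0 (in_T zT).
    apply: contraTneq pos => q1; rewrite -leNgt.
    by apply: (le_trans (shortfall_q (in_T zT))); rewrite q1 subrr mulr0.
  have h := @mass_increment_le shortfall (- 1) (- kap) x y x0 xy yT.
  rewrite /e_fill; rewrite normrN1 in h; apply: h.
  + move=> j jj; have [z xzy rz] := routed_from x0 xy yT jj.
    have zT : sigma1 <= z <= T.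
      by move: xzy => /andP[xz zy]; rewrite (le_trans s1x (ltW xz)) (le_trans zy).
    have jT : (0 < j <= arr y)%N.
      by move: jj => /andP[h ->]; rewrite (leq_ltn_trans _ h).
    have yT' : 0 <= y <= T by rewrite (le_trans x0 xy).
    rewrite -(routed_sum_at yT' jT) -sumrN; apply: ler_sum => k _.
    have [Lk|kL] := leqP L (ntasks (nu k)).
      rewrite rz dispatch_low ?mul0r ?oppr0//; first exact: q_below_1 (in_T zT) (capped_at (in_T zT)).
        exact: low.
      by rewrite idxK (threshold_eq zT).
    rewrite -[leRHS]mulrN1 ler_wpM2l ?routed_ge0// /shortfall ntasks_incr.
    by rewrite (subn_decompS kL) natrD opprD addNKr.
  + move=> z /andP[xz zy].
    have zT : sigma1 <= z <= T by rewrite (le_trans s1x (ltW xz)) (le_trans zy).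
    (* For pools with at most L tasks the whole departure rate counts and the second
       term is nonnegative; for the other ones the bound is nonnegative. *)
    have hd : mass (drift_rate shortfall) z <=
        mass (fun v => 1 * service v + (- delta) * (tasks v - L%:R)) z.
      apply: mass_le => [|v _]; first exact: in_T.
      apply: (le_trans (drift_le v)); rewrite mul1r; case: ifP => h.
        rewrite mulr1 lerDl mulNr oppr_ge0 mulr_ge0_le0 ?(ltW delta_gt0)//.
        by rewrite subr_le0 /tasks ler_nat.
      rewrite mulr0 mulNr subr_ge0; apply: le_trans (service_ge v).
      by rewrite ler_wpM2l ?(ltW delta_gt0)// gerBl.
    have e : mass (fun v => tasks v - L%:R) z = mass tasks z - L%:R.
      have -> : mass (fun v => tasks v - L%:R) z =
        mass (fun v => 1 * tasks v + (-1) * L%:R) z.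
        by apply: eq_mass => v; rewrite mul1r mulN1r.
      rewrite (mass_lin 1 (-1) tasks (fun=> L%:R)) mass_cst ?in_T//; ring.
    rewrite (mass_lin 1 (- delta) service (fun v => tasks v - L%:R)) e in hd.
    have ms := mass_service zT; have kl := kap_le.
    have := tasks_near zT; rewrite ler_norml => /andP[h1 _].
    have : delta * (rho - slack - L%:R) <= delta * (mass tasks z - L%:R).
      by rewrite ler_pM2l//; lra.
    lra.
- by rewrite t1.
Qed.

Definition excess (v : profile r) : R := (ntasks v - (L + Delta))%N%:R.

Lemma excess_le_tasks t : 0 <= t <= T -> mass excess t <= mass tasks t.
Proof.
by move=> tT; apply: mass_le => // v _; rewrite /excess /tasks ler_nat leq_subr.
Qed.

Let e_drain := eps * (2 * oscillation excess).

(** Pools with L + Delta tasks or more receive no task, and a pool with more loses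
tasks at a rate at least delta times its excess. *)
Lemma drain sigma t : sigma1 <= sigma -> sigma <= t <= T ->
  mass excess t * expR (ln (1 + delta) * (t - sigma)) <=
  (1 + delta) * (rho + slack +
     e_drain * (T - sigma + 1) * expR (ln (1 + delta) * (T - sigma))).
Proof.
move=> s1s st.
have sT : sigma1 <= sigma <= T by move: st => /andP[h1 h2]; rewrite s1s (le_trans h1).
have osc0 := oscillation_ge0 excess.
have ed0 : 0 <= e_drain by rewrite /e_drain mulr_ge0// mulr_ge0.
have step : forall x y c, sigma <= x -> x <= y -> y <= T ->
    (forall z, x < z <= y -> c <= mass excess z) ->
    mass excess y - mass excess x <= - delta * c * (y - x) + e_drain.
  move=> x y c sx xy yT Hc.
  have s1x := le_trans s1s sx; have x0 := le_trans sigma1_ge0 s1x.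
  have h := @mass_increment_le excess 0 (- delta * c) x y x0 xy yT.
  rewrite normr0 mulr0 add0r in h; apply: h.
  + move=> j jj; have [z xzy rz] := routed_from x0 xy yT jj.
    have zT : sigma1 <= z <= T.
      by move: xzy => /andP[xz zy]; rewrite (le_trans s1x (ltW xz)) (le_trans zy).
    apply: sumr_le0 => k _.
    have [Lk|kL] := leqP (L + Delta) (ntasks (nu k)).
      rewrite rz dispatch_full ?mul0r//; first exact: q_below_1 (in_T zT) (capped_at (in_T zT)).
      by rewrite idxK (threshold_eq zT).
    rewrite /excess ntasks_incr.
    rewrite (eqP (kL : (_ - _ == 0)%N)) (eqP (ltnW kL : (_ - _ == 0)%N)).
    by rewrite subrr mulr0.
  + move=> z xzy; have := Hc z xzy; move: xzy => /andP[xz zy].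
    have zT : sigma1 <= z <= T by rewrite (le_trans s1x (ltW xz)) (le_trans zy).
    rewrite mul0r add0r => cz.
    apply: (@le_trans _ _ (mass (fun v => (- delta) * excess v + 0 * excess v) z)).
      apply: mass_le => [|v _]; first exact: in_T.
      rewrite (drift_of_level (fun i => (i - (L + Delta))%N%:R)) mul0r addr0.
      have [vh|hv] := leqP (ntasks v) (L + Delta).
        rewrite /excess (eqP (vh : (_ - _ == 0)%N)).
        have vh' := leq_trans (leq_pred _) vh.
        by rewrite (eqP (vh' : (_ - _ == 0)%N)) subrr !mulr0.
      rewrite (subn_decomp_pred hv) natrD opprD addNKr mulrN1 mulNr lerN2.
      apply: le_trans (service_ge v); rewrite ler_wpM2l ?(ltW delta_gt0)//.
      by rewrite /excess /tasks ler_nat leq_subr.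
    by rewrite mass_lin mul0r addr0 !mulNr lerN2 ler_pM2l.
have H := @discrete_decay R (mass excess) sigma T e_drain delta delta_gt0 ed0.
apply: (le_trans (H _ step t st)).
  move=> x /andP[sx xT]; apply: mass_ge0 => //.
  by rewrite (le_trans sigma1_ge0 (le_trans s1s sx)).
rewrite ler_pM2l ?addr_gt0//.
rewrite lerD2r; apply: (le_trans (excess_le_tasks (in_T sT))).
have := tasks_near sT; rewrite ler_norml => /andP[_]; lra.
Qed.

Lemma excess_series t c : 0 <= t <= T ->
  (\sum_(0 <= i <oo | (L + Delta < i)%N) (q nu (s t) i * c)%:E)%E =
  (mass excess t * c)%:E.
Proof.
by move=> tT; rewrite (excess_sum (capped_support (capped_at tT))).
Qed.

End plateau.

Lemma equilibrium_regime (sigma1 sigma alpha delta kap e0 e : R) (f : nat) :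
  let L := (f * Delta)%N in
  let rho := \sum_m equil lambda mu p m in
  let slack := r.+1%:R * alpha in
  (forall y T' C eps', 0 <= C -> eps' <= e0 ->
     approx_system lambda B%:R mu p y T' C eps' ->
     forall m t, sigma1 <= t <= T' -> `|y m t - equil lambda mu p m| <= alpha) ->
  0 <= sigma1 -> L%:R <= rho - slack -> rho + slack < (L + Delta)%:R ->
  0 < delta -> (forall m, delta <= (1 - p m) * mu m) ->
  0 < kap -> alpha * \sum_m mu m + kap <= delta * (rho - slack - L%:R) ->
  eps <= 1 -> (forall m, eps * (2 + 2 * oscillation (in_phase m)) <= e) -> e <= e0 ->
  eps * (2 * 1 + 2 * oscillation (shortfall f)) <= e ->
  eps * (2 * oscillation (excess f)) <= e ->
  sigma1 + L%:R / kap <= sigma ->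
  forall t, sigma <= t <= T ->
  [/\ l t = L,
      (forall i, (i <= L)%N -> `|1 - q nu (s t) i| <= 2 * e) &
      (\sum_(0 <= i <oo | (L + Delta < i)%N)
         (q nu (s t) i * expR (ln (1 + delta) * (t - sigma)))%:E <=
       ((1 + delta) * (rho + slack +
          e * (T - sigma + 1) * expR (ln (1 + delta) * (T - sigma))))%:E)%E].
Proof.
move=> L rho slack Hcasc s0 gl gh d0 dm k0 kl eps1 ep ee0 es ex sgm t /andP[st tT].
have near m x : sigma1 <= x <= T -> `|mass (in_phase m) x - equil lambda mu p m| <= alpha.
  exact: (Hcasc _ _ _ _ (ler0n R M) ee0 (phases_system eps1 ep)).
have Lk : 0 <= L%:R / kap by rewrite divr_ge0// ltW.
have s1s : sigma1 <= sigma by lra.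
have tT1 : sigma1 <= t <= T by rewrite (le_trans s1s st).
have tT0 : 0 <= t <= T by rewrite (le_trans s0 (le_trans s1s st)).
split.
- exact: (threshold_eq s0 near gl gh tT1).
- move=> i iL; apply: (le_trans (q_shortfall tT0 iL)).
  have st' : sigma1 + (f * Delta)%:R / kap <= t <= T by rewrite (le_trans sgm st).
  apply: (le_trans (filling s0 near gl gh d0 dm k0 kl st')).
  by rewrite ler_pM2l.
- rewrite (excess_series _ _ tT0) lee_fin.
  have st' : sigma <= t <= T by rewrite st.
  apply: (le_trans (drain s0 near gl gh d0 dm s1s st')).
  rewrite ler_pM2l ?addr_gt0// lerD2l ler_wpM2r ?expR_ge0// ler_wpM2r//.
  by lra.
Qed.

End trajectory.

(** * Almost sure properties and suprema *)

Section almost_everywhere.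
Context {d1 d2 : measure_display} {T1 : measurableType d1} {T2 : measurableType d2}.
Context {R : realType}.

Lemma ae_fst (m1 : {measure set T1 -> \bar R}) (m2 : {sigma_finite_measure set T2 -> \bar R})
    (A : T1 -> Prop) :
  (\forall x \ae m1, A x) -> \forall w \ae (m1 \x m2)%E, A w.1.
Proof.
move=> [S [mS S0 AS]]; exists (S `*` setT); split.
- exact: measurableX.
- by apply: etrans (product_measure1E _ _ mS measurableT) _; rewrite S0 mul0e.
- by move=> w /= h; split => //; apply: AS.
Qed.

Lemma ae_snd (m1 : {measure set T1 -> \bar R}) (m2 : {sigma_finite_measure set T2 -> \bar R})
    (A : T2 -> Prop) :
  (\forall x \ae m2, A x) -> \forall w \ae (m1 \x m2)%E, A w.2.
Proof.
move=> [S [mS S0 AS]]; exists (setT `*` S); split.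
- exact: measurableX.
- by apply: etrans (product_measure1E _ _ measurableT mS) _; rewrite S0 mule0.
- by move=> w /= h; split => //; apply: AS.
Qed.

(** Used for the clocks, which are indexed by a countable type. *)
Lemma ae_forall_countable (I : countType) (m : {measure set T1 -> \bar R})
    (A : I -> T1 -> Prop) :
  (forall i, \forall x \ae m, A i x) -> \forall x \ae m, forall i, A i x.
Proof.
move=> H; pose B k x := if choice.unpickle k is Some i then A i x else True.
have HB : \forall x \ae m, forall k, B k x.
  apply: ae_foralln => k; rewrite /B; case: choice.unpickle => [i|]; first exact: H.
  exact: nearW.
by apply: filterS HB => x Bx i; have := Bx (choice.pickle i); rewrite /B choice.pickleK.
Qed.

End almost_everywhere.

Section suprema.
Context {R : realType}.
Variables (a b : R).
Hypothesis ab : a <= b.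

Lemma sup_cvg0 (F : nat -> R -> R) : (forall n t, 0 <= F n t) ->
  (forall e, 0 < e -> \forall n \near \oo, forall t, a <= t <= b -> F n t <= e) ->
  ereal_sup [set (F n t)%:E | t in `[a, b]] @[n --> \oo] --> 0%E.
Proof.
move=> F0 H.
have lo n : (0 <= ereal_sup [set (F n t)%:E | t in `[a, b]])%E.
  apply: (@le_trans _ _ (F n a)%:E); first by rewrite lee_fin.
  by apply: ereal_sup_ubound; exists a => //=; rewrite in_itv/= lexx.
have up e : 0 < e -> \forall n \near \oo,
    (ereal_sup [set (F n t)%:E | t in `[a, b]] <= e%:E)%E.
  move=> /H; apply: filterS => n Hn; apply: ge_ereal_sup => _ /= [t + <-].
  by rewrite in_itv/= => /Hn; rewrite lee_fin.
have fin : \forall n \near \oo, ereal_sup [set (F n t)%:E | t in `[a, b]] \is a fin_num.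
  have := up 1 ltr01; apply: filterS => n un.
  by rewrite ge0_fin_numE// (le_lt_trans un)// ltry.
apply/fine_cvgP; split => //; apply/cvgrPdist_le => e e0.
have := up e e0; apply: filterS2 fin => n fn un.
rewrite sub0r normrN /= ger0_norm; last exact: fine_ge0.
by rewrite -lee_fin fineK.
Qed.

Lemma limn_esup_bound (u : (\bar R)^nat) (c : \bar R) :
  (\forall n \near \oo, (u n <= c)%E) -> (limn_esup u <= c)%E.
Proof.
move=> [n0 _ H]; rewrite /limn_esup /limf_esup.
apply: (@le_trans _ _ (ereal_sup [set u n | n in [set n | (n0 <= n)%N]])).
  by apply: ereal_inf_lbound; exists [set n | (n0 <= n)%N] => //; exists n0.
by apply: ge_ereal_sup => _ /= [n nn <-]; exact: H.
Qed.

End suprema.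

(** * Sample paths of large systems *)

Section sample_path.
Context {R : realType} {r : nat}.
Variables (Delta : nat) (lambda : R) (mu p : 'I_r.+1 -> R).
Variables (nu : nat -> profile r) (idx : profile r -> nat).
Hypothesis Delta_gt0 : (0 < Delta)%N.
Hypothesis lambda_ge0 : 0 <= lambda.
Hypothesis mu_gt0 : forall m, 0 < mu m.
Hypothesis p01 : forall m, 0 <= p m <= 1.
Hypothesis p_last : p ord_max = 0.
Hypotheses (nuK : cancel nu idx) (idxK : cancel idx nu).

Variables (N : clock r -> R -> nat) (U : nat -> R).
Hypothesis N0 : forall c, N c 0 = 0%N.
Hypothesis Nmono : forall c t u, 0 <= t -> t <= u -> (N c t <= N c u)%N.
Hypothesis Nrc : forall c t, 0 <= t -> N c x @[x --> t^'+] --> N c t.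
Hypothesis Nlln : forall c (K eps : R), 0 < eps -> \forall n \near \oo,
  forall th, 0 <= th <= K -> `|n%:R^-1 * (N c (n%:R * th))%:R - th| <= eps.
Hypothesis U01 : forall j, (0 < j)%N -> 0 <= U j < 1.

Variables (T : R) (B : nat).
Variables (s0 : nat -> profile r -> R).
Variables (s : nat -> R -> profile r -> R) (l : nat -> R -> nat).
Hypothesis T_ge0 : 0 <= T.
Hypothesis init_simplex : forall n, (0 < n)%N -> simplex (s0 n).
Hypothesis init_counts : forall n v, (0 < n)%N -> exists k : nat, n%:R * s0 n v = k%:R.
Hypothesis init_bounded : forall n, (0 < n)%N -> q nu (s0 n) B.+1 = 0.
Hypothesis traj : forall n, (0 < n)%N ->
  is_trajectory Delta lambda mu p nu idx N U n (s n) (l n) T (s0 n).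

Lemma occupation_bounds n v t : (0 < n)%N -> 0 <= t <= T ->
  0 <= \int[@lebesgue_measure R]_(x in `[0, t]) s n x v <= T.
Proof.
move=> n0 tT.
have := @integral_bounds R T (fun k x => s n x (nu k))
  (fun k => @s_rc _ _ _ _ _ _ _ _ _ _ _ _ _ _ _ (traj n0) (nu k))
  (fun k => @s01 _ _ _ _ _ _ _ _ _ _ _ _ _ _ _ (traj n0) (nu k)) (idx v) t tT.
by rewrite idxK => /andP[-> h] /=; apply: (le_trans h); case/andP: tT.
Qed.

(** Each clock runs at most up to n times a constant, because the time spent in a
profile is at most T; finitely many clocks are considered. *)
Lemma fluid_errors K (eps : R) : 0 < eps -> \forall n \near \oo, [/\ (0 < n)%N,
  (forall t, 0 <= t <= T -> `|n%:R^-1 * (arrivals lambda N n t)%:R - lambda * t| <= eps),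
  (forall t k m, 0 <= t <= T -> (k < K)%N ->
     `|P_ mu p N n (s n) t (nu k) m - p (src m) * mu (src m) * (nu k (src m))%:R *
        \int[@lebesgue_measure R]_(x in `[0, t]) s n x (nu k)| <= eps) &
  (forall t k m, 0 <= t <= T -> (k < K)%N ->
     `|D_ mu p N n (s n) t (nu k) m - (1 - p m) * mu m * (nu k m)%:R *
        \int[@lebesgue_measure R]_(x in `[0, t]) s n x (nu k)| <= eps)].
Proof.
move=> eps0.
have HA := @Nlln (arrival_clock r) (lambda * T) eps eps0.
have HP : \forall n \near \oo, forall k : 'I_K, forall m : 'I_r,
    forall th, 0 <= th <= p (src m) * mu (src m) * (nu k (src m))%:R * T ->
    `|n%:R^-1 * (N (transition_clock (nu k) (src m)) (n%:R * th))%:R - th| <= eps.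
  by apply: filter_forall => k; apply: filter_forall => m; exact: Nlln.
have HD : \forall n \near \oo, forall k : 'I_K, forall m : 'I_r.+1,
    forall th, 0 <= th <= (1 - p m) * mu m * (nu k m)%:R * T ->
    `|n%:R^-1 * (N (departure_clock (nu k) m) (n%:R * th))%:R - th| <= eps.
  by apply: filter_forall => k; apply: filter_forall => m; exact: Nlln.
have n_gt0 : \forall n \near \oo, (0 < n)%N by exists 1%N.
near=> n.
have n0 : (0 < n)%N by near: n.
split => //.
- move=> t /andP[t0 tT]; rewrite /arrivals -mulrA.
  have Hn : forall th, 0 <= th <= lambda * T ->
    `|n%:R^-1 * (N (arrival_clock r) (n%:R * th))%:R - th| <= eps by near: n.
  by apply: Hn; rewrite mulr_ge0// ler_wpM2l.
- move=> t k m tT kK; rewrite (P_integralE idxK (traj n0))//.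
  have Hn : forall k : 'I_K, forall m : 'I_r,
    forall th, 0 <= th <= p (src m) * mu (src m) * (nu k (src m))%:R * T ->
    `|n%:R^-1 * (N (transition_clock (nu k) (src m)) (n%:R * th))%:R - th| <= eps.
    by near: n.
  have /andP[I0 IT] := occupation_bounds (nu k) n0 tT.
  have c0 : 0 <= p (src m) * mu (src m) * (nu k (src m))%:R.
    by rewrite !mulr_ge0 ?(ltW (mu_gt0 _))//; case/andP: (p01 (src m)).
  by apply: (Hn (Ordinal kK)); rewrite mulr_ge0//= ler_wpM2l.
- move=> t k m tT kK; rewrite (D_integralE idxK (traj n0))//.
  have Hn : forall k : 'I_K, forall m : 'I_r.+1,
    forall th, 0 <= th <= (1 - p m) * mu m * (nu k m)%:R * T ->
    `|n%:R^-1 * (N (departure_clock (nu k) m) (n%:R * th))%:R - th| <= eps.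
    by near: n.
  have /andP[I0 IT] := occupation_bounds (nu k) n0 tT.
  have c0 : 0 <= (1 - p m) * mu m * (nu k m)%:R.
    by rewrite !mulr_ge0 ?(ltW (mu_gt0 _))// subr_ge0; case/andP: (p01 m).
  by apply: (Hn (Ordinal kK)); rewrite mulr_ge0//= ler_wpM2l.
Unshelve. all: by end_near.
Qed.

(** The cap M on the number of tasks of a pool is fixed first, then the finite set of
profiles, then the precision eps required for the clocks, which depends on this
set through the oscillations. *)
Lemma path_regime (sigma1 sigma alpha delta kap e0 e : R) (f : nat) :
  let L := (f * Delta)%N in
  let rho := \sum_m equil lambda mu p m in
  let slack := r.+1%:R * alpha in
  (forall y T' C eps', 0 <= C -> eps' <= e0 ->
     approx_system lambda B%:R mu p y T' C eps' ->
     forall m t, sigma1 <= t <= T' -> `|y m t - equil lambda mu p m| <= alpha) ->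
  0 <= sigma1 -> L%:R <= rho - slack -> rho + slack < (L + Delta)%:R ->
  0 < delta -> (forall m, delta <= (1 - p m) * mu m) ->
  0 < kap -> alpha * \sum_m mu m + kap <= delta * (rho - slack - L%:R) ->
  0 < e -> e <= e0 -> sigma1 + L%:R / kap <= sigma ->
  \forall n \near \oo, forall t, sigma <= t <= T ->
  [/\ l n t = L,
      (forall i, (i <= L)%N -> `|1 - q nu (s n t) i| <= 2 * e) &
      (\sum_(0 <= i <oo | (L + Delta < i)%N)
         (q nu (s n t) i * expR (ln (1 + delta) * (t - sigma)))%:E <=
       ((1 + delta) * (rho + slack +
          e * (T - sigma + 1) * expR (ln (1 + delta) * (T - sigma))))%:E)%E].
Proof.
move=> L rho slack Hcasc s00 gl gh d0 dm k0 kl epos ee0 sgm.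
(* For n large the number of arrivals per pool is at most lambda * T + 1. *)
have [M _ HM] := nbhs_infty_ger (B%:R + (lambda * T + 1) + Delta%:R).
have {}HM := HM M (leqnn M).
have [K HK] := exists_profile_bound idx M.
pose os := @oscillation R r nu K.
have os0 phi : 0 <= os phi by exact: oscillation_ge0.
pose Ctot := 1 + \sum_m (2 + 2 * os (@in_phase R r m)) +
  (2 * 1 + 2 * os (shortfall Delta f)) + 2 * os (excess Delta f).
have Cm0 m : 0 <= 2 + 2 * os (@in_phase R r m) by rewrite addr_ge0// mulr_ge0.
have Cs0 : 0 <= \sum_m (2 + 2 * os (@in_phase R r m)) by exact: sumr_ge0.
have C1 : 1 <= Ctot.
  have := os0 (shortfall Delta f); have := os0 (excess Delta f).
  by rewrite /Ctot /os; lra.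
have C0 : 0 < Ctot by exact: lt_le_trans C1.
pose eps := Num.min e 1 / Ctot.
have m0 : 0 < Num.min e 1 by rewrite lt_min epos ltr01.
have eps0 : 0 < eps by exact: divr_gt0.
have epsC x : 0 <= x -> x <= Ctot -> eps * x <= Num.min e 1.
  move=> x0 xC; apply: (@le_trans _ _ (eps * Ctot)).
    by rewrite ler_wpM2l// ltW.
  by rewrite /eps divfK// gt_eqF.
have eps_le x : 0 <= x -> x <= Ctot -> eps * x <= e.
  by move=> x0 xC; apply: (le_trans (epsC x x0 xC)); rewrite ge_min lexx.
have eps1 : eps <= 1.
  rewrite -[leLHS]mulr1; apply: (le_trans (epsC 1 ler01 C1)).
  by rewrite ge_min lexx orbT.
have := fluid_errors K eps0; apply: filterS => n [n0 eA eP eD].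
have TT : 0 <= T <= T by rewrite T_ge0 lexx.
have ML : B%:R + n%:R^-1 * (arrivals lambda N n T)%:R + Delta%:R <= M%:R :> R.
  apply: le_trans HM; rewrite lerD2r lerD2l.
  by have := eA T TT; rewrite ler_norml => /andP[_]; lra.
apply: (equilibrium_regime Delta_gt0 lambda_ge0 mu_gt0 p01 nuK idxK N0 Nmono Nrc U01
  n0 T_ge0 (traj n0) (init_simplex n0) (fun v => init_counts v n0) (init_bounded n0)
  HK ML eA eP eD p_last Hcasc s00 gl gh d0 dm k0 kl eps1 _ ee0 _ _ sgm).
- move=> m; apply: eps_le; first exact: Cm0.
  have h : 2 + 2 * os (@in_phase R r m) <= \sum_m (2 + 2 * os (@in_phase R r m)).
    by rewrite (bigD1 m)//= lerDl sumr_ge0.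
  apply: (le_trans h); rewrite /Ctot; move: Cs0.
  have := os0 (shortfall Delta f); have := os0 (excess Delta f).
  by lra.
- apply: eps_le; first by rewrite addr_ge0// mulr_ge0.
  by move: Cs0; have := os0 (excess Delta f); rewrite /Ctot /os; lra.
- apply: eps_le; first by rewrite mulr_ge0.
  by move: Cs0; have := os0 (shortfall Delta f); rewrite /Ctot /os; lra.
Qed.

End sample_path.

(** * The theorem *)

(** The constant sigma is the time for the phases to settle, plus the time L / kap
for the shortfall to be filled at speed kap; eta is ln (1 + delta), where delta is
a lower bound on the departure rate of a task in any phase; and c exceeds 1 + delta
times the mean number of tasks per pool at time sigma, for n large. A property has
probability one on the completed product space iff it holds almost everywhere for
the product measure. *)
Theorem theorem3 (R : realType) (r Delta : nat) (lambda : R)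
  (mu p : 'I_r.+1 -> R) (nu : nat -> profile r) (idx : profile r -> nat)
  (d1 d2 d3 : measure_display)
  (T1 : measurableType d1) (T2 : measurableType d2) (T3 : measurableType d3)
  (P1 : probability T1 R) (P2 : probability T2 R) (P3 : probability T3 R)
  (N : clock r -> R -> T1 -> nat) (U : nat -> T2 -> R)
  (s0 : nat -> T3 -> profile r -> R) (s_lim : profile r -> R) (B : nat) :
  (0 < Delta)%N ->
  0 <= lambda ->
  (forall m, 0 < mu m) ->
  (forall m : 'I_r.+1, (m < r)%N -> 0 < p m < 1) ->
  p ord_max = 0 ->
  cancel nu idx -> cancel idx nu ->
  independent_unit_poisson P1 N ->
  iid_uniform P2 U ->
  initial_condition P3 nu Delta s0 s_lim B ->
  (forall i : nat, load lambda mu p <> (i * Delta)%:R) ->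
  let L : int := floor_mul Delta (load lambda mu p) in
  exists sigma eta c : R,
    [/\ 0 < sigma, 0 < eta & 0 < c] /\
    forall (T : R) (s : nat -> T1 * T2 * T3 -> R -> profile r -> R)
           (l : nat -> T1 * T2 * T3 -> R -> nat),
      0 < T ->
      (\forall w \ae ((P1 \x P2) \x P3)%E, forall n, (0 < n)%N ->
         is_trajectory Delta lambda mu p nu idx
           (fun a t => N a t w.1.1) (fun j => U j w.1.2) n
           (s n w) (l n w) T (s0 n w.2)) ->
      sigma <= T ->
      \forall w \ae ((P1 \x P2) \x P3)%E,
        [/\ ereal_sup [set `|(l n w t)%:R - L%:~R : R|%:E | t in `[sigma, T]]
              @[n --> \oo] --> 0%E,
            (forall i : nat, i%:Z <= L ->
               ereal_sup [set `|1 - q nu (s n w t) i|%:E | t in `[sigma, T]]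
                 @[n --> \oo] --> 0%E) &
            (limn_esup (fun n =>
               ereal_sup [set \sum_(0 <= i <oo | (L + Delta%:Z < i%:Z)%R)
                                (q nu (s n w t) i
                                   * expR (eta * (t - sigma)))%:E
                         | t in `[sigma, T]])
             <= c%:E)%E].
Proof.
move=> Delta_gt0 lambda_ge0 mu_gt0 p01 p_last nuK idxK HN HU HI load_ne L.
have p01' m : 0 <= p m <= 1.
  have [mr|rm] := ltnP m r; first by have /andP[p0 p1] := p01 m mr; rewrite !ltW.
  have -> : m = ord_max by apply: val_inj => /=; have := ltn_ord m; lia.
  by rewrite p_last lexx ler01.
have plt1 m : p m < 1.
  have [mr|rm] := ltnP m r; first by have /andP[] := p01 m mr.
  have -> : m = ord_max by apply: val_inj => /=; have := ltn_ord m; lia.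
  by rewrite p_last ltr01.
have Delta0 : (0 : R) < Delta%:R by rewrite ltr0n.
pose rho := \sum_m equil lambda mu p m.
have rhoE : load lambda mu p = rho by exact: load_equil.
have rho0 : 0 <= rho by apply: sumr_ge0 => m _; exact: equil_ge0.
have [f Lf] : exists f : nat, L = (f * Delta)%N%:Z.
  have : 0 <= Num.floor (load lambda mu p / Delta%:R).
    by rewrite floor_ge0 rhoE divr_ge0// ltW.
  rewrite /L /floor_mul; case: Num.floor => // f _.
  by exists f; rewrite PoszM.
have /andP[Lrho rhoL] : (f * Delta)%:R <= rho < (f * Delta + Delta)%:R.
  have := floor_mul_bounds (load lambda mu p) Delta_gt0.
  by rewrite -/L Lf rhoE natrD.
(* This is where the load must not be a multiple of Delta. *)
have {Lrho} Lrho : (f * Delta)%:R < rho.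
  rewrite lt_neqAle Lrho andbT; apply/eqP => e.
  by apply: (load_ne f); rewrite rhoE e.
set Ln := (f * Delta)%N in Lf Lrho rhoL *.
pose delta := \big[Num.min/1]_m ((1 - p m) * mu m).
have delta_gt0 : 0 < delta.
  rewrite /delta; elim/big_ind : _ => [//|x y x0 y0|m _]; first by rewrite lt_min x0.
  by rewrite mulr_gt0// subr_gt0.
have delta_le m : delta <= (1 - p m) * mu m.
  by rewrite /delta (bigD1 m)//= ge_min lexx.
(* The distance from rho to the multiples of Delta. *)
pose g := Num.min (rho - Ln%:R) ((Ln + Delta)%:R - rho).
have g_gt0 : 0 < g by rewrite lt_min !subr_gt0 Lrho.
have g1 : g <= rho - Ln%:R by rewrite ge_min lexx.
have g2 : g <= (Ln + Delta)%:R - rho by rewrite ge_min lexx orbT.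
(* Half of the drift delta * g / 2 left by the slack on rho; the other half
   absorbs the slack on the departure rate. *)
pose kap := delta * g / 4.
have kap_gt0 : 0 < kap by rewrite divr_gt0// mulr_gt0.
have mu_sum : 0 <= \sum_m mu m by apply: sumr_ge0 => m _; exact: ltW.
pose alpha := Num.min (g / (2 * r.+1%:R)) (kap / (\sum_m mu m + 1)).
have ms1 : 0 < \sum_m mu m + 1 by rewrite ltr_wpDl.
have alpha_gt0 : 0 < alpha.
  by rewrite lt_min !divr_gt0// mulr_gt0.
have slack_le : r.+1%:R * alpha <= g / 2.
  apply: (@le_trans _ _ (r.+1%:R * (g / (2 * r.+1%:R)))).
    by rewrite ler_wpM2l// ge_min lexx.
  by rewrite le_eqVlt; apply/orP; left; apply/eqP; field.
have kap_le : alpha * \sum_m mu m <= kap.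
  apply: (@le_trans _ _ (kap / (\sum_m mu m + 1) * (\sum_m mu m + 1))).
    apply: ler_pM => //; [exact: ltW|by rewrite ge_min lexx orbT|by rewrite lerDl].
  by rewrite divfK// gt_eqF.
have [sigma1 [e0 [sigma1_ge0 e0_gt0 Hcasc]]] :=
  cascade_uniform lambda_ge0 (ler0n R B) mu_gt0 p01' alpha_gt0.
pose sigma := sigma1 + Ln%:R / kap + 1.
have gap_low : Ln%:R <= rho - r.+1%:R * alpha by lra.
have gap_high : rho + r.+1%:R * alpha < (Ln + Delta)%:R by lra.
have kap_le' : alpha * \sum_m mu m + kap <= delta * (rho - r.+1%:R * alpha - Ln%:R).
  apply: (@le_trans _ _ (delta * (g / 2))); first by rewrite /kap in kap_le *; lra.
  by rewrite ler_pM2l//; lra.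
have Lkap0 : 0 <= Ln%:R / kap by rewrite divr_ge0// ltW.
exists sigma, (ln (1 + delta)), ((1 + delta) * (rho + r.+1%:R * alpha + 1)).
split.
  split; first by rewrite /sigma; lra.
    by rewrite ln_gt0// ltrDl.
  by rewrite mulr_gt0//; have := mulr_ge0 (ler0n R r.+1) (ltW alpha_gt0); lra.
move=> T s l T_gt0 Htraj sigmaT.
have [HNp _] := HN.
have good1 : \forall w \ae ((P1 \x P2) \x P3)%E, forall c : clock r,
    [/\ N c 0 w.1.1 = 0%N,
        (forall t u, 0 <= t -> t <= u -> (N c t w.1.1 <= N c u w.1.1)%N),
        (forall t, 0 <= t -> N c x w.1.1 @[x --> t^'+] --> N c t w.1.1) &
        forall K eps : R, 0 < eps -> \forall n \near \oo,
          forall th, 0 <= th <= K ->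
          `|n%:R^-1 * (N c (n%:R * th) w.1.1)%:R - th| <= eps].
  pose G w1 := forall c : clock r,
    [/\ N c 0 w1 = 0%N,
        (forall t u, 0 <= t -> t <= u -> (N c t w1 <= N c u w1)%N),
        (forall t, 0 <= t -> N c x w1 @[x --> t^'+] --> N c t w1) &
        forall K eps : R, 0 < eps -> \forall n \near \oo,
          forall th, 0 <= th <= K ->
          `|n%:R^-1 * (N c (n%:R * th) w1)%:R - th| <= eps].
  apply: (@ae_fst _ _ _ _ R (P1 \x P2)%E P3 (fun w => G w.1)).
  apply: (@ae_fst _ _ _ _ R P1 P2 G).
  apply: (@ae_forall_countable _ _ R (profile r * 'I_r.+2 * bool)%type P1) => c.
  exact: poisson_lln_path (HNp c).
have good2 : \forall w \ae ((P1 \x P2) \x P3)%E, forall j, (0 < j)%N ->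
    0 <= U j w.1.2 < 1.
  pose G w2 := forall j, (0 < j)%N -> 0 <= U j w2 < 1.
  apply: (@ae_fst _ _ _ _ R (P1 \x P2)%E P3 (fun w => G w.2)).
  apply: (@ae_snd _ _ _ _ R P1 P2 G).
  exact: iid_uniform_range HU.
have good3 : \forall w \ae ((P1 \x P2) \x P3)%E, forall n, (0 < n)%N ->
    q nu (s0 n w.2) B.+1 = 0.
  pose G w3 := forall n, (0 < n)%N -> q nu (s0 n w3) B.+1 = 0.
  apply: (@ae_snd _ _ _ _ R (P1 \x P2)%E P3 G).
  by apply: filterS (initial_bounded HI) => w Hw n n0; have [] := Hw n n0.
have FF : Filter (almost_everywhere ((P1 \x P2) \x P3)%E).
  exact: ae_filter_ringOfSetsType.
have good12 := @filterI _ _ FF _ _ good1 good2.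
apply: (@filterS3 _ _ FF _ _ _ _ _ good12 good3 Htraj) => w [w1 w2] w3 w4.
have T_ge0 : 0 <= T by exact: ltW.
have s1s : sigma1 + Ln%:R / kap <= sigma by rewrite /sigma lerDl.
have regime e (e_gt0 : 0 < e) (ee0 : e <= e0) :=
  @path_regime R r Delta lambda mu p nu idx Delta_gt0 lambda_ge0
  mu_gt0 p01' p_last nuK idxK (fun c t => N c t w.1.1) (fun j => U j w.1.2)
  (fun c => let: And4 h _ _ _ := w1 c in h)
  (fun c => let: And4 _ h _ _ := w1 c in h)
  (fun c => let: And4 _ _ h _ := w1 c in h)
  (fun c => let: And4 _ _ _ h := w1 c in h)
  w2 T B (fun n => s0 n w.2) (fun n => s n w) (fun n => l n w) T_ge0
  (fun n => @initial_simplex _ _ _ _ _ _ _ _ _ _ HI n w.2)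
  (fun n v => @initial_counts _ _ _ _ _ _ _ _ _ _ HI n w.2 v)
  w3 w4 sigma1 sigma alpha delta kap e0 e f Hcasc sigma1_ge0 gap_low gap_high
  delta_gt0 delta_le kap_gt0 kap_le' e_gt0 ee0 s1s.
have small e : 0 < e -> exists2 e', 0 < e' <= e0 & 2 * e' <= e.
  move=> e_gt0; exists (Num.min e0 (e / 2)).
    by rewrite lt_min e0_gt0 divr_gt0//= ge_min lexx.
  have : Num.min e0 (e / 2) <= e / 2 by rewrite ge_min lexx orbT.
  by lra.
split.
- apply: (@sup_cvg0 _ _ _ sigmaT (fun n t => `|(l n w t)%:R - L%:~R|)) => // e e_gt0.
  have := regime e0 e0_gt0 (lexx e0); apply: filterS => n Hn t tT.
  by have [-> _ _] := Hn t tT; rewrite Lf subrr normr0 ltW.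
- move=> i iL.
  apply: (@sup_cvg0 _ _ _ sigmaT (fun n t => `|1 - q nu (s n w t) i|)) => // e e_gt0.
  have [e' /andP[e'0 e'e0] e'e] := small e e_gt0.
  have := regime e' e'0 e'e0; apply: filterS => n Hn t tT.
  have [_ Hq _] := Hn t tT; apply: le_trans (Hq i _) e'e.
  by move: iL; rewrite Lf.
- pose X := (T - sigma + 1) * expR (ln (1 + delta) * (T - sigma)).
  have X0 : 0 < X by rewrite mulr_gt0 ?expR_gt0//; lra.
  pose e := Num.min e0 X^-1.
  have e_gt0 : 0 < e by rewrite lt_min e0_gt0 invr_gt0.
  have ee0 : e <= e0 by rewrite ge_min lexx.
  have eX : e * X <= 1.
    rewrite -(mulVf (lt0r_neq0 X0)) ler_pM2r//.
    by rewrite ge_min lexx orbT.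
  apply: limn_esup_bound.
  have := regime e e_gt0 ee0; apply: filterS => n Hn.
  apply: ge_ereal_sup => _ /= [t + <-]; rewrite in_itv/= => tT.
  have [_ _ HW] := Hn t tT.
  have -> : (\sum_(0 <= i <oo | (L + Delta%:Z < i%:Z)%R)
      (q nu (s n w t) i * expR (ln (1 + delta) * (t - sigma)))%:E =
    \sum_(0 <= i <oo | (Ln + Delta < i)%N)
      (q nu (s n w t) i * expR (ln (1 + delta) * (t - sigma)))%:E)%E.
    by apply: eq_eseriesl => i; rewrite Lf -PoszD ltz_nat.
  apply: (le_trans HW); rewrite lee_fin ler_pM2l ?addr_gt0//.
  by rewrite lerD2l -mulrA.
Qed.
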